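(* Let $K$ be a compact hypergroup with Haar measure $\omega$ and let $\sigma$ be an adapted probability measure on $K$. Then $H^p_\sigma(K)=\mathbb{C}1$ for all $1\leq p\leq\infty$.
   Context: $K$ is a compact hypergroup (Jewett/Bloom–Heyer sense) with involution $x\mapsto\check x$ and left Haar measure $\omega$; $L^p(K)$ is taken with respect to $\omega$. For a Borel function $f$, $f(x*y)=\int_K f\,d(\delta_x*\delta_y)$, and for $\mu\in M(K)$, $(\mu*f)(x)=\int_K f(\check y*x)\,d\mu(y)$. $H^p_\sigma(K)=\{f\in L^p(K):\sigma*f=f\}$, and $1$ is the constant function one. For subsets $A,B\subseteq K$, $A*B=\bigcup_{a\in A,b\in B}\operatorname{supp}(\delta_a*\delta_b)$, $A^n$ is the $n$-fold product and $\check A=\{\check a: a\in A\}$. A measure $\mu\in M(K)$ is adapted if $K=\overline{\bigcup_{n\geq1}\left(\operatorname{supp}|\mu|\cup(\operatorname{supp}|\mu|)\check{}\right)^n}$. *)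

(* Defs.v *)
From HB Require Import structures.
From mathcomp Require Import all_boot all_algebra.
From mathcomp Require Import all_classical all_reals all_analysis.
Import GRing.Theory Num.Theory numFieldNormedType.Exports.

Set Implicit Arguments.
Unset Strict Implicit.
Unset Printing Implicit Defensive.

Local Open Scope classical_set_scope.
Local Open Scope ring_scope.

(* The Borel sigma-algebra of a topological space K, as a measurable type
   (definitionally equal to K). *)
Notation Borel K := (g_sigma_algebraType (@open K)).

Section Hypergroup.
Context {R : realType} {K : ptopologicalType}.

Definition msupp (mu : {measure set (Borel K) -> \bar R}) : set K :=
  [set z | forall U : set K, open U -> U z -> (0 < mu U)%E].

Definition radon (mu : {measure set (Borel K) -> \bar R}) : Prop :=
  (mu [set: K] < +oo)%E /\
  (forall A : set (Borel K), measurable A ->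
     mu A = ereal_inf [set mu U | U in [set U : set K | open U /\ A `<=` U]]) /\
  (forall U : set K, open U ->
     mu U = ereal_sup [set mu C | C in [set C : set K | compact C /\ C `<=` U]]).

Variables (conv : K -> K -> probability (Borel K) R) (e : K) (inv : K -> K).

Definition fconv (f : K -> R) (x y : K) : \bar R :=
  (\int[conv x y]_w (f w)%:E)%E.

(* Jewett / Bloom-Heyer axioms for a compact hypergroup K whose
   convolution is determined by delta_x * delta_y = conv x y, with identity e
   and involution inv. *)
Definition is_compact_hypergroup : Prop :=
  [/\ compact [set: K] /\ hausdorff_space K,
    (forall x y, radon (conv x y) /\ compact (msupp (conv x y))),
    (* associativity: (delta_x * delta_y) * delta_z = delta_x * (delta_y * delta_z) *)
    (forall (x y z : K) (f : K -> R), continuous f ->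
       (\int[conv x y]_u fconv f u z = \int[conv y z]_v fconv f x v)%E) /\
    (forall f : K -> R, continuous f ->
       continuous (fun xy : K * K => fconv f xy.1 xy.2)),
    (* (x,y) |-> supp(delta_x * delta_y) is continuous for the Michael topology *)
    (forall U : set K, open U ->
       open [set xy : K * K | msupp (conv xy.1 xy.2) `&` U !=set0] /\
       open [set xy : K * K | msupp (conv xy.1 xy.2) `<=` U]) &
    [/\
      (forall (x : K) (A : set (Borel K)), measurable A ->
         conv e x A = (\1_A x)%:E /\ conv x e A = (\1_A x)%:E),
      continuous inv /\ involutive inv,
      (forall (x y : K) (A : set (Borel K)), measurable A ->
         conv x y (inv @^-1` A) = conv (inv y) (inv x) A) &
      (forall x y : K, msupp (conv x y) e <-> x = inv y)]].

Definition is_left_haar (omega : {measure set (Borel K) -> \bar R}) : Prop :=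
  [/\ radon omega, (0 < omega [set: K])%E &
    forall (x : K) (f : K -> R), continuous f ->
      (\int[omega]_y fconv f x y = \int[omega]_y (f y)%:E)%E].

Definition setconv (A B : set K) : set K :=
  [set z | exists a b, [/\ A a, B b & msupp (conv a b) z]].

(* setpow A n = A^(n+1) *)
Fixpoint setpow (A : set K) (n : nat) : set K :=
  match n with
  | O => A
  | S m => setconv (setpow A m) A
  end.

(* sigma adapted: K = closure (U_{n>=1} (supp sigma U (supp sigma)^check)^n)
   (for a probability measure, |sigma| = sigma). *)
Definition adapted (sigma : {measure set (Borel K) -> \bar R}) : Prop :=
  let S := msupp sigma `|` (inv @` msupp sigma) in
  closure (\bigcup_n setpow S n) = [set: K].

Definition mconv (mu : {measure set (Borel K) -> \bar R}) (f : K -> R) (x : K)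
  : \bar R := (\int[mu]_y fconv f (inv y) x)%E.

(* Complex-valued functions f = u + i v on K are represented by the pair (u, v)
   of real functions; integrals are taken componentwise. *)
Definition inLp (omega : {measure set (Borel K) -> \bar R}) (p : \bar R)
    (u v : K -> R) : Prop :=
  [/\ measurable_fun [set: Borel K] (u : Borel K -> R),
      measurable_fun [set: Borel K] (v : Borel K -> R) &
      (Lnorm omega p (fun x : Borel K => (Num.sqrt (u x ^+ 2 + v x ^+ 2))%:E)
         < +oo)%E].

Definition Hp (omega : {measure set (Borel K) -> \bar R})
    (sigma : {measure set (Borel K) -> \bar R}) (p : \bar R) (u v : K -> R) : Prop :=
  [/\ inLp omega p u v,
      {ae omega, forall x : Borel K, mconv sigma u x = (u x)%:E} &
      {ae omega, forall x : Borel K, mconv sigma v x = (v x)%:E}].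

End Hypergroup.

(* Main.v *)
Require Import Defs.
From HB Require Import structures.
From mathcomp Require Import all_boot all_order all_algebra.
From mathcomp Require Import all_classical all_reals all_analysis.
From mathcomp Require Import finmap measurable_realfun ess_sup_inf lra ring.
Import Order.TTheory GRing.Theory Num.Theory numFieldNormedType.Exports.

(** Let [P f = sigma * f]; [omega] is [P]-invariant, so [P] contracts [L^1], and
    [L^p] is contained in [L^1]. For continuous [psi] the operator
    [Q k x = \int psi(z) k(x * z) d omega(z)] maps [L^1] into the continuous
    functions (left invariance bounds the sup norm of [Q k] by the [L^1] norm of
    [k]) and commutes with [P]; hence [Q u] is continuous and harmonic when [u]
    is harmonic. A continuous harmonic [h] satisfies
    [\int\int\int (h(w) - h(x))^2 d(delta_{inv y} * delta_x)(w) d sigma(y) d omega(x) = 0],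
    so [h] is constant equal to [h(x)] on the support of [delta_a * delta_x] for
    all [x] and all [a] in [inv (supp sigma)]. The set of such [a] is closed and
    stable under convolution and inversion, hence is [K] by adaptedness, and
    [x = e] shows that [h] is constant. Integrating the identity [Q u = const]
    against the right invariant image of [omega] under [inv] gives
    [omega(K) \int psi u = \int psi \int u] for all [psi], so [u] is constant a.e.

    [K] need not be second countable, so the maps [(y, x) |-> (delta_y * delta_x)(A)]
    are not known to be measurable for the product sigma-algebra; the
    [L^1]-contractivity of [P] is obtained from the tau-additivity of Radon
    measures on open sets and a Dynkin class argument. *)

Set Implicit Arguments.
Unset Strict Implicit.
Unset Printing Implicit Defensive.

Local Open Scope classical_set_scope.
Local Open Scope ring_scope.

(** * Continuous functions on a compact space *)

Section Composition.
Context {S T U V : topologicalType}.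

Lemma continuous_pair (f : S -> T) (g : S -> U) :
  continuous f -> continuous g -> continuous (fun x => (f x, g x)).
Proof. by move=> cf cg x; apply: cvg_pair; [exact: cf|exact: cg]. Qed.

Lemma continuous_comp2 (F : T * U -> V) (f : S -> T) (g : S -> U) :
  continuous F -> continuous f -> continuous g ->
  continuous (fun x => F (f x, g x)).
Proof.
move=> cF cf cg x; apply: (@continuous_comp _ _ _ (fun x => (f x, g x)) F).
  exact: continuous_pair.
exact: cF.
Qed.

End Composition.

Section CompactSpace.
Context {R : realType} {K : ptopologicalType}.

Lemma open_measurable_Borel (U : set K) : open U -> measurable (U : set (Borel K)).
Proof. by move=> oU; apply: sub_sigma_algebra. Qed.

Lemma closed_measurable_Borel (C : set K) :
  closed C -> measurable (C : set (Borel K)).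
Proof.
move=> cC; rewrite -[C]setCK; apply: measurableC.
by apply: open_measurable_Borel; exact: closed_openC.
Qed.

Lemma lsc_measurable (f : K -> R) : (forall a, open [set x | a < f x]) ->
  measurable_fun [set: Borel K] (f : Borel K -> R).
Proof.
move=> lf; apply: (measurability _ (RGenOInfty.measurableE R)).
move=> _ [_ [r ->] <-]; rewrite setTI.
have -> : f @^-1` `]r, +oo[ = [set x | r < f x].
  by apply/seteqP; split=> x /=; rewrite in_itv/= andbT.
exact: open_measurable_Borel.
Qed.

Lemma continuous_open_gt (T : topologicalType) (f : T -> R) a :
  continuous f -> open [set x | a < f x].
Proof.
move=> cf; have -> : [set x | a < f x] = f @^-1` [set r | r > a] by [].
by apply: open_comp => // x _; apply: cf.
Qed.

Lemma continuous_measurable (f : K -> R) : continuous f ->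
  measurable_fun [set: Borel K] (f : Borel K -> R).
Proof. by move=> cf; apply: lsc_measurable => a; exact: continuous_open_gt. Qed.

Lemma continuous_bound (T : topologicalType) (f : T -> R) :
  compact [set: T] -> continuous f ->
  exists2 M : R, 0 <= M & forall x, `|f x| <= M.
Proof.
move=> cT cf; have /compact_bounded : compact [set f x | x in [set: T]].
  by apply: continuous_compact cT; exact: continuous_subspaceT.
move=> [M0 [_ /(_ (Num.max M0 0 + 1))]].
have M0n : M0 < Num.max M0 0 + 1 by rewrite ltr_pwDr// le_max lexx.
move=> /(_ M0n) H; exists (Num.max M0 0 + 1).
  by rewrite addr_ge0// le_max lexx orbT.
by move=> x; apply: H; exists x.
Qed.

Hypothesis cK : compact [set: K].

Lemma bounded_integrable (mu : {finite_measure set (Borel K) -> \bar R})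
    (f : K -> R) M :
  measurable_fun [set: Borel K] (f : Borel K -> R) -> (forall x, `|f x| <= M) ->
  mu.-integrable [set: Borel K] (EFin \o (f : Borel K -> R)).
Proof.
move=> mf fM; apply: (@le_integrable _ _ _ _ _ _ _ (EFin \o cst M)) => //.
- exact/measurable_EFinP.
- by move=> x _ /=; rewrite lee_fin (le_trans (fM x))// ler_norm.
- exact: finite_measure_integrable_cst.
Qed.

Lemma continuous_integrable (mu : {finite_measure set (Borel K) -> \bar R})
    (f : K -> R) : continuous f ->
  mu.-integrable [set: Borel K] (EFin \o (f : Borel K -> R)).
Proof.
move=> cf; have [M _ fM] := continuous_bound cK cf.
by apply: bounded_integrable fM; exact: continuous_measurable.
Qed.

Lemma continuous_integralE (mu : {finite_measure set (Borel K) -> \bar R})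
    (f : K -> R) : continuous f ->
  (\int[mu]_x (f x)%:E)%E = (\int[mu]_(x in [set: Borel K]) f x)%:E.
Proof.
by move=> cf; rewrite /Rintegral fineK//; apply: integrable_fin_num => //;
  exact: continuous_integrable.
Qed.

Lemma cst_Rintegral (mu : {finite_measure set (Borel K) -> \bar R}) (r : R) :
  \int[mu]_(x in [set: Borel K]) r = r * fine (mu setT).
Proof. exact: Rintegral_cst. Qed.

Lemma Rintegral_bound (mu : {finite_measure set (Borel K) -> \bar R})
    (f : K -> R) M : continuous f -> (forall x, `|f x| <= M) ->
  `|\int[mu]_(x in [set: Borel K]) f x| <= M * fine (mu setT).
Proof.
move=> cf fM; apply: le_trans.
  by apply: le_normr_Rintegral => //; exact: continuous_integrable.
rewrite -cst_Rintegral; apply: le_Rintegral => //.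
  by apply: (@continuous_integrable mu (fun x => `|f x|)) => x; apply: cvg_norm; exact: cf.
exact: finite_measure_integrable_cst.
Qed.

(** Continuity at each [(w, t0)] gives a product neighbourhood; compactness of [K] makes the
    neighbourhood of [t0] independent of [w]. *)
Lemma tube (T : topologicalType) (G : K * T -> R) t0 (eps : R) :
  continuous G -> 0 < eps ->
  \forall t \near t0, forall w, `|G (w, t) - G (w, t0)| < eps.
Proof.
move=> cG e0; have [cov _] := compact_near_coveringP [set: K].
have := cov cK T (nbhs t0) (fun t w => `|G (w, t) - G (w, t0)| < eps) _.
move=> H; have {}H := H _.
have : \forall t \near t0, [set: K] `<=` (fun w => `|G (w, t) - G (w, t0)| < eps).
  apply: H => w _.
  have e2 : 0 < eps / 2 by rewrite divr_gt0.
  have /cvgrPdist_lt/(_ _ e2)[[A B] /= [nA nB] AB] := cG (w, t0).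
  exists (A, B) => //= -[w' t] /= [Aw Bt].
  have H1 := AB (w', t) (conj Aw Bt).
  have H2 := AB (w', t0) (conj Aw (nbhs_singleton nB)).
  rewrite (_ : G (w', t) - _ = (G (w, t0) - G (w', t0)) - (G (w, t0) - G (w', t))); last by ring.
  rewrite [eps]splitr (le_lt_trans (ler_normB _ _))// ltrD//.
by apply: filterS => t H' w; apply: H'.
Qed.

(** Both the measure and the integrand move with [t]. Freezing the integrand at [t0] leaves a
    difference controlled by weak continuity of [mu]; the rest is controlled by [tube] and the mass
    bound [M]. *)
Lemma cvg_continuous_Rintegral (T : topologicalType)
    (mu : T -> {finite_measure set (Borel K) -> \bar R}) (M : R) (G : K * T -> R) :
  (forall t, fine (mu t setT) <= M) ->
  (forall f : K -> R, continuous f ->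
    continuous (fun t => \int[mu t]_(x in [set: Borel K]) f x)) ->
  continuous G ->
  continuous (fun t => \int[mu t]_(x in [set: Borel K]) G (x, t)).
Proof.
move=> muM cmu cG t0.
have cGt t : continuous (fun x : K => G (x, t)).
  by apply: continuous_comp2 cG _ _ => x; [exact: cvg_id|exact: cvg_cst].
apply/cvgrPdist_lt => eps e0.
have M1 : 0 < M + 1 by rewrite ltr_wpDl// (le_trans _ (muM t0)) ?fine_ge0.
have d0 : 0 < eps / 2 / (M + 1) by rewrite !divr_gt0.
have e2 : 0 < eps / 2 by rewrite divr_gt0.
near=> t.
have -> : \int[mu t0]_(x in [set: Borel K]) G (x, t0) -
    \int[mu t]_(x in [set: Borel K]) G (x, t) =
  (\int[mu t0]_(x in [set: Borel K]) G (x, t0) - \int[mu t]_(x in [set: Borel K]) G (x, t0)) -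
   \int[mu t]_(x in [set: Borel K]) (G (x, t) - G (x, t0)).
  rewrite RintegralB//; first by ring.
    exact: (continuous_integrable _ (cGt t)).
  exact: (continuous_integrable _ (cGt t0)).
rewrite [eps]splitr (le_lt_trans (ler_normB _ _))// ltr_leD//.
  by near: t; have /cvgrPdist_lt/(_ _ e2) := cmu _ (cGt t0) t0.
apply: (@le_trans _ _ (eps / 2 / (M + 1) * fine (mu t setT))).
  apply: (@Rintegral_bound (mu t) (fun x => G (x, t) - G (x, t0))).
    by move=> x; apply: cvgB; exact: cGt.
  move=> x; apply: ltW; move: x; near: t; exact: tube.
rewrite -mulrA ler_piMr ?(ltW e2)// mulrC ler_pdivrMr// mul1r (le_trans (muM t))//.
by rewrite lerDl.
Unshelve. all: by end_near. Qed.

End CompactSpace.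

(** * Fubini for continuous integrands and Urysohn cutoffs *)

Section RadonMeasures.
Context {R : realType} {K : ptopologicalType}.
Hypotheses (cK : compact [set: K]) (hK : hausdorff_space K).

(* The open set [G > a] need not belong to the product of the Borel
   sigma-algebras a priori; compactness of the sets [G >= a + 1/n] exhibits it as
   a countable union of open rectangles. *)
Lemma continuous_measurable_prod (G : K * K -> R) : continuous G ->
  measurable_fun [set: (Borel K * Borel K)%type] (G : Borel K * Borel K -> R).
Proof.
move=> cG; apply: (measurability _ (RGenOInfty.measurableE R)).
move=> _ [_ [a ->] <-]; rewrite setTI.
have rect (p : K * K) : exists AB : set K * set K, a < G p ->
    [/\ open AB.1, open AB.2, (AB.1 `*` AB.2) p & AB.1 `*` AB.2 `<=` [set q | a < G q]].
  have [ap|nap] := boolP (a < G p); last by exists (set0, set0).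
  have : nbhs p [set q | a < G q].
    by apply: open_nbhs_nbhs; split => //; exact: continuous_open_gt.
  case=> -[A B] /= [nA nB] AB.
  exists (interior A, interior B) => _ /=; split => //; first exact: open_interior.
    exact: open_interior.
  by move=> [x y] [/= Ax By]; apply: AB; split; exact: interior_subset.
have [f fP] := choice rect.
have cov (n : nat) : exists D : {fset K * K},
    [set q | a + n.+1%:R^-1 <= G q] `<=`
    \bigcup_(p in [set` D] `&` [set p | a < G p]) ((f p).1 `*` (f p).2).
  have /compact_near_coveringP cC : compact [set q : K * K | a + n.+1%:R^-1 <= G q].
    have -> : [set q : K * K | a + n.+1%:R^-1 <= G q] =
        [set: K * K] `&` G @^-1` [set r | a + n.+1%:R^-1 <= r] by rewrite setTI.
    apply: compact_closedI; first by rewrite -setXTT; exact: compact_setX.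
    by apply: closed_comp => // x _; exact: cG.
  (* Finite sets of base points, filtered by inclusion, turn the near-covering form of compactness
     into the extraction of a finite subcover by rectangles. *)
  pose F := filter_from [set: {fset K * K}] (fun E => [set D | (E `<=` D)%fset]).
  have FF : Filter F.
    apply: filter_from_filter; first by exists fset0.
    move=> D E _ _; exists (D `|` E)%fset => // H /= DEH.
    by split; apply: fsubset_trans DEH; [exact: fsubsetUl|exact: fsubsetUr].
  have [|D _ /(_ D (fsubset_refl D)) DP] := cC _ F (fun D q =>
      (\bigcup_(p in [set` D] `&` [set p | a < G p]) ((f p).1 `*` (f p).2)) q) FF.
    move=> q /= aq; have aq' : a < G q by rewrite (lt_le_trans _ aq)// ltrDl invr_gt0.
    have [oA oB [/= Aq Bq] _] := fP _ aq'.
    exists ((f q).1 `*` (f q).2, [set D | ([fset q] `<=` D)%fset]) => /=.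
      split; last by exists [fset q]%fset.
      by exists ((f q).1, (f q).2) => //=; split; exact: open_nbhs_nbhs.
    move=> [q' D] [/= q'f]; rewrite fsub1set => qD.
    by exists q.
  by exists D.
have [D DP] := choice cov.
have -> : G @^-1` `]a, +oo[ =
    \bigcup_n \bigcup_(p in [set` D n] `&` [set p | a < G p]) ((f p).1 `*` (f p).2).
  apply/seteqP; split=> [q|q [n _ [p /= [pD ap]]]].
    rewrite /= in_itv/= andbT => aq.
    have /ltr_add_invr[n an] := aq.
    by exists n => //; apply: (DP n) => /=; exact: ltW.
  by rewrite in_itv/= andbT; have [_ _ _] := fP _ ap; apply.
apply: bigcupT_measurable => n; apply: fin_bigcup_measurable.
  exact: finite_setIl.
move=> p /= [pD ap]; have [oA oB _ _] := fP _ ap.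
by apply: measurableX; exact: open_measurable_Borel.
Qed.

Lemma Fubini_continuous (mu nu : {finite_measure set (Borel K) -> \bar R})
    (G : K * K -> R) : continuous G ->
  \int[mu]_(x in [set: Borel K]) \int[nu]_(y in [set: Borel K]) G (x, y) =
  \int[nu]_(y in [set: Borel K]) \int[mu]_(x in [set: Borel K]) G (x, y).
Proof.
move=> cG.
have c1 x : continuous (fun y => G (x, y)).
  by apply: continuous_comp2 cG _ _ => y; [exact: cvg_cst|exact: cvg_id].
have c2 y : continuous (fun x => G (x, y)).
  by apply: continuous_comp2 cG _ _ => x; [exact: cvg_id|exact: cvg_cst].
rewrite [LHS]/Rintegral [RHS]/Rintegral; congr fine.
under eq_integral do rewrite -(continuous_integralE cK _ (c1 _)).
under [RHS]eq_integral do rewrite -(continuous_integralE cK _ (c2 _)).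
apply: (@Fubini _ _ _ _ _ mu nu (EFin \o G)).
have mG := continuous_measurable_prod cG.
apply/integrable12ltyP; first exact/measurable_EFinP.
have cKK : compact [set: K * K] by rewrite -setXTT; exact: compact_setX.
have [M M0 GM] := continuous_bound cKK cG.
apply: (@le_lt_trans _ _ (\int[mu]_x (M * fine (nu setT))%:E)%E); last first.
  by rewrite integral_cst// ltey_eq fin_numM// fin_num_measure.
apply: ge0_le_integral => //.
- by move=> x _; exact: integral_ge0.
- have := @measurable_fun_fubini_tonelli_F _ _ (Borel K) (Borel K) R nu
    (fun p : Borel K * Borel K => `|(G p)%:E|)%E.
  apply => //.
  by apply/measurableT_comp => //; exact/measurable_EFinP.
- move=> x _; rewrite EFinM fineK ?fin_num_measure// -integral_cst//.
  apply: ge0_le_integral => //.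
  + by apply/measurableT_comp => //; apply/measurable_EFinP; exact: continuous_measurable.
  + by move=> y _; rewrite lee_fin.
Qed.

Lemma urysohn_cutoff (C U : set K) : closed C -> open U -> C `<=` U ->
  exists f : K -> R, [/\ continuous f, (forall x, 0 <= f x <= 1),
    (forall x, C x -> f x = 1) & (forall x, ~ U x -> f x = 0)].
Proof.
move=> cC oU CU.
have sep : uniform_separator (~` U) C.
  apply: (normal_separatorP.1 (compact_normal hK cK)) => //; first exact: open_closedC.
  by rewrite -subset0 => x [nU /CU].
exists (Urysohn (~` U) C); split.
- exact: Urysohn_continuous.
- by move=> x; have := @Urysohn_range _ R (~` U) C _ (ex_intro2 _ _ x I erefl); rewrite /= in_itv.
- by move=> x Cx; apply: (Urysohn_sub1 sep); exists x.
- by move=> x Ux; apply: (Urysohn_sub0 sep); exists x.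
Qed.

Lemma Rintegral_sum_indic (mu : {finite_measure set (Borel K) -> \bar R})
    (N : nat) (A : nat -> set (Borel K)) : (forall i, measurable (A i)) ->
  mu.-integrable setT (EFin \o (fun x => \sum_(i < N) \1_(A i) x)) /\
  \int[mu]_x (\sum_(i < N) \1_(A i) x) = \sum_(i < N) fine (mu (A i)).
Proof.
move=> mA; have iA i : mu.-integrable setT (EFin \o \1_(A i)).
  apply: (@bounded_integrable _ _ mu _ 1) => // x.
  by rewrite indicE; case: (_ \in _); rewrite ?normr1 ?normr0.
elim: N => [|N [iN IH]].
  have -> : (fun x : Borel K => \sum_(i < 0) \1_(A i) x : R) = cst 0.
    by apply/funext => x; rewrite big_ord0.
  by rewrite big_ord0 Rintegral_cst// mul0r; split => //; exact: finite_measure_integrable_cst.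
have -> : (fun x => \sum_(i < N.+1) \1_(A i) x) =
    (fun x => \sum_(i < N) \1_(A i) x + \1_(A N) x :> R).
  by apply/funext => x; rewrite big_ord_recr.
rewrite big_ord_recr/= RintegralD// IH; split; first exact: (integrableD _ iN (iA N)).
by rewrite /Rintegral integral_indic// setIT.
Qed.

End RadonMeasures.

(** * Radon measures *)

Section TauAdditivity.
Context {R : realType} {K : ptopologicalType}.
Hypotheses (cK : compact [set: K]) (hK : hausdorff_space K).
Variable mu : {finite_measure set (Borel K) -> \bar R}.

Lemma compact_measurable_Borel (C : set K) :
  compact C -> measurable (C : set (Borel K)).
Proof. by move=> cC; apply: closed_measurable_Borel; exact: compact_closed. Qed.

Lemma radon_inner (U : set K) (eps : R) : radon mu -> open U -> 0 < eps ->
  exists2 C : set K, compact C /\ C `<=` U & fine (mu U) - eps < fine (mu C).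
Proof.
move=> [_ [_ inner]] oU e0.
have fU : mu U \is a fin_num by apply: fin_num_measure; exact: open_measurable_Borel.
have UE := inner _ oU.
have : ((fine (mu U) - eps)%:E < mu U)%E by rewrite -[ltRHS]fineK// lte_fin ltrBlDr ltrDl.
rewrite {2}UE => /ereal_sup_gt[_ [C [cC CU] <-] lt]; exists C => //.
rewrite -lte_fin fineK//; apply: fin_num_measure; exact: compact_measurable_Borel.
Qed.

Lemma radon_outer (A : set (Borel K)) (eps : R) : radon mu -> measurable A -> 0 < eps ->
  exists2 U : set K, open U /\ A `<=` U & fine (mu U) < fine (mu A) + eps.
Proof.
move=> [_ [outer _]] mA e0.
have fA : mu A \is a fin_num by exact: fin_num_measure.
have : (mu A < (fine (mu A) + eps)%:E)%E by rewrite -[ltLHS]fineK// lte_fin ltrDl.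
rewrite {1}outer// => /ereal_inf_lt[_ [U [oU AU] <-] lt]; exists U => //.
rewrite -lte_fin fineK//; apply: fin_num_measure; exact: open_measurable_Borel.
Qed.

(** Layer-cake discretization with step [d]: a function is traded for finitely many superlevel sets
    at a pointwise cost of at most [d]. The third clause, saturation of the count, carries the
    induction. *)
Lemma layer_count (d t : R) (N : nat) : 0 <= d -> 0 <= t ->
  [/\ d * \sum_(i < N) (i.+1%:R * d < t)%R%:R <= t,
    (t <= N%:R * d -> t <= d + d * \sum_(i < N) (i.+1%:R * d < t)%R%:R) &
    (N%:R * d < t -> \sum_(i < N) (i.+1%:R * d < t)%R%:R = N%:R :> R)].
Proof.
move=> d0 t0; elim: N => [|N [IH1 IH2 IH3]].
  by rewrite big_ord0 !mul0r mulr0 addr0; split => // /le_trans; apply.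
rewrite big_ord_recr/= -natr1 mulrDl mul1r; have [tN|Nt] := leP t (N%:R * d).
  have -> : (N%:R * d + d < t) = false by apply/negbTE; rewrite -leNgt (le_trans tN)// lerDl.
  by rewrite addr0; split => //; move=> _; exact: IH2.
rewrite IH3//; have [Ndt|tNd] := ltP (N%:R * d + d) t.
  rewrite mulr1n mulrDr mulr1 [d * _]mulrC; split=> //; first exact: ltW.
rewrite mulr0n addr0 [d * _]mulrC; split; first exact: ltW.
  by rewrite addrC.
by [].
Qed.

Section Directed.
Variables (D : set (K -> R)) (phi0 : K -> R).
Hypotheses (D0 : D phi0) (Ddir : forall f g, D f -> D g ->
  exists2 h, D h & forall x, f x <= h x /\ g x <= h x).

Lemma directed_seq (I : eqType) (g : I -> K -> R) (s : seq I) :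
  (forall i, i \in s -> D (g i)) ->
  exists2 h, D h & forall i, i \in s -> forall x, g i x <= h x.
Proof.
elim: s => [_|i s IH Ds]; first by exists phi0.
have [|h Dh hs] := IH; first by move=> j js; apply: Ds; rewrite inE js orbT.
have [k Dk hk] := Ddir (Ds i (mem_head _ _)) Dh; exists k => // j.
by rewrite inE => /orP[/eqP->|/hs js] x; [exact: (hk x).1|exact: le_trans (hk x).2].
Qed.

Hypothesis Dc : forall f, D f -> continuous f.

(** Finitely many of the open sets where a member of [D] exceeds [a] cover [C]; a common upper bound
    of these members in [D] exceeds [a] on all of [C]. *)
Lemma directed_compact (C : set K) (a : R) : compact C ->
  (forall x, C x -> exists2 f, D f & a < f x) ->
  exists2 h, D h & forall x, C x -> a < h x.
Proof.
move=> cC Ca.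
have /choice[g gP] (x : K) : exists f, C x -> D f /\ a < f x.
  by have [/Ca[f Df af]|nCx] := pselect (C x); [exists f|exists phi0].
have := cC; rewrite compact_cover => /(_ _ C (fun x => [set y | a < g x y])) [].
- by move=> x /gP[/Dc cg _]; exact: continuous_open_gt.
- by move=> x Cx; exists x => //=; exact: (gP x Cx).2.
move=> E EC CE; have [|h Dh hE] := @directed_seq _ g (enum_fset E).
  by move=> x xE; have /set_mem/gP[] := EC x xE.
exists h => // x /CE[y /= yE ay]; apply: (lt_le_trans ay); exact: hE.
Qed.

(* [D] may be uncountable, so monotone convergence does not apply: [F] is cut into
   finitely many layers [F > i/N], each exhausted by a compact set on which a
   single member of [D] already exceeds [i/N]. *)
Lemma radon_directed_sup (F : K -> R) (c : R) : radon mu ->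
  (forall f x, D f -> 0 <= f x <= F x) -> (forall x, F x <= 1) ->
  (forall x a, a < F x -> exists2 f, D f & a < f x) ->
  c < \int[mu]_(x in [set: Borel K]) F x ->
  exists2 f, D f & c < \int[mu]_(x in [set: Borel K]) f x.
Proof.
move=> rmu DF F1 supF cF.
have oF a : open [set x | a < F x].
  have -> : [set x | a < F x] = \bigcup_(f in D) [set x | a < f x].
    apply/seteqP; split=> [x /supF[f Df af]|x [f Df af]]; first by exists f.
    by apply: (lt_le_trans af); have /andP[] := DF _ x Df.
  by apply: bigcup_open => f Df; exact/continuous_open_gt/Dc.
have F0 x : 0 <= F x by have /andP[] := DF _ x D0; exact: le_trans.
have FN1 x : `|F x| <= 1 by rewrite ger0_norm.
have iF := bounded_integrable mu (lsc_measurable oF) FN1.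
set W := fine (mu setT); have W0 : 0 <= W by rewrite fine_ge0.
set IF := \int[mu]_(x in [set: Borel K]) F x in cF *.
(* With [d = 1/(N+1)], the loss is at most [d * W] from the discretization plus [d * 1] from the
   compact sets, since each of the [N+1] layers loses mass at most [d]. This [N] brings the total
   below [IF - c]. *)
have [N NP] : exists N : nat, (W + 1) / N.+1%:R < IF - c.
  have e0 : 0 < (IF - c) / (W + 1) by rewrite divr_gt0 ?subr_gt0// ltr_wpDl.
  have [N] := ltr_add_invr e0; rewrite add0r => NP; exists N.
  by rewrite mulrC -ltr_pdivlMr// ltr_wpDl.
pose d : R := N.+1%:R^-1; have d0 : 0 < d by rewrite invr_gt0.
pose O i := [set x | i.+1%:R * d < F x].
have /choice[C CP] (i : nat) : exists C : set K, [/\ compact C, C `<=` O i &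
    fine (mu (O i)) - d < fine (mu C)].
  by have [C [? ?] ?] := radon_inner rmu (oF (i.+1%:R * d)) d0; exists C.
have /choice[h hP] (i : nat) : exists h, D h /\ forall x, C i x -> i.+1%:R * d < h x.
  have [cC CO _] := CP i.
  have [|h Dh hC] := directed_compact (a := i.+1%:R * d) cC; last by exists h.
  by move=> x /CO; exact: supF.
have [|k Dk hk] := @directed_seq _ h (iota 0 N.+1).
  by move=> i _; have [] := hP i.
exists k => //.
have mO i : measurable (O i : set (Borel K)).
  by apply: open_measurable_Borel; exact: oF.
have mC i : measurable (C i : set (Borel K)).
  by have [? _ _] := CP i; exact: compact_measurable_Borel.
have [iO eO] := Rintegral_sum_indic mu N.+1 mO.
have [iC eC] := Rintegral_sum_indic mu N.+1 mC.
have up : IF <= d * W + d * \sum_(i < N.+1) fine (mu (O i)).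
  rewrite -eO -RintegralZl// -(cst_Rintegral mu) -RintegralD//; last 2 first.
  - exact: finite_measure_integrable_cst.
  - exact: integrableZl iO.
  apply: le_Rintegral => //.
    have i1 := finite_measure_integrable_cst mu d measurableT.
    exact: (integrableD _ i1 (integrableZl _ d iO)).
  move=> x _; have [_ + _] := layer_count N.+1 (ltW d0) (F0 x).
  rewrite {1}/d mulfV ?pnatr_eq0// => /(_ (F1 x)) /le_trans; apply.
  rewrite lerD2l; apply: ler_wpM2l; first exact: ltW.
  apply: ler_sum => i _; rewrite indicE /O; case: ltP => //= iF'.
  by rewrite mem_set.
have lo : d * \sum_(i < N.+1) fine (mu (C i)) <= \int[mu]_(x in [set: Borel K]) k x.
  rewrite -eC -RintegralZl//; apply: le_Rintegral => //.
    exact: integrableZl iC.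
    exact/continuous_integrable/Dc.
  move=> x _; have k0 : 0 <= k x by have /andP[] := DF _ x Dk.
  have [+ _ _] := layer_count N.+1 (ltW d0) k0; apply: le_trans.
  apply: ler_wpM2l; first exact: ltW.
  apply: ler_sum => i _; rewrite indicE; have [/set_mem Cx|] := boolP (x \in C i) => //=.
  have -> : i.+1%:R * d < k x; last by [].
  by apply: lt_le_trans ((hP i).2 x Cx) _; apply: hk; rewrite mem_iota/= add0n.
apply: lt_le_trans lo.
have : \sum_(i < N.+1) fine (mu (O i)) - 1 <= \sum_(i < N.+1) fine (mu (C i)).
  have -> : 1 = \sum_(i < N.+1) d by rewrite sumr_const card_ord -[RHS]mulr_natr /d mulVf// pnatr_eq0.
  rewrite -sumrB; apply: ler_sum => i _; apply: ltW; by have [] := CP i.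
move: NP; rewrite -/d => NP H.
have := ler_wpM2l (ltW d0) H; rewrite mulrBr mulr1 => H'.
lra.
Qed.

End Directed.
End TauAdditivity.

(** * Density of continuous functions in [L^1] of a Radon measure *)

Section Density.
Context {R : realType} {K : ptopologicalType}.
Hypotheses (cK : compact [set: K]) (hK : hausdorff_space K).
Variable mu : {finite_measure set (Borel K) -> \bar R}.
Hypothesis rmu : radon mu.

Definition approximable (f : K -> R) :=
  measurable_fun [set: Borel K] (f : Borel K -> R) /\
  forall eps : R, 0 < eps -> exists2 k : K -> R, continuous k &
    (\int[mu]_(x in [set: Borel K]) (`|f x - k x|%:E) < eps%:E)%E.

Lemma measurable_dist (f g : K -> R) :
  measurable_fun [set: Borel K] (f : Borel K -> R) ->
  measurable_fun [set: Borel K] (g : Borel K -> R) ->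
  measurable_fun [set: Borel K] (fun x : Borel K => `|f x - g x|%:E).
Proof.
move=> mf mg; apply/measurable_EFinP; apply: measurableT_comp => //.
exact: measurable_funB.
Qed.

Lemma L1_triangle (f g h : K -> R) :
  measurable_fun [set: Borel K] (f : Borel K -> R) ->
  measurable_fun [set: Borel K] (g : Borel K -> R) ->
  measurable_fun [set: Borel K] (h : Borel K -> R) ->
  (\int[mu]_(x in [set: Borel K]) (`|f x - h x|%:E) <=
   \int[mu]_(x in [set: Borel K]) (`|f x - g x|%:E) +
   \int[mu]_(x in [set: Borel K]) (`|g x - h x|%:E))%E.
Proof.
move=> mf mg mh; rewrite -ge0_integralD//; try exact: measurable_dist.
apply: ge0_le_integral => //; first exact: measurable_dist.
- by apply: emeasurable_funD; exact: measurable_dist.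
- by move=> x _; rewrite -EFinD lee_fin ler_distD.
Qed.

(** Inner regularity is available on open sets, so the compact set [C] is taken inside an open hull
    [U] of [A] and may leave [A]. A cutoff between [C] and [U] differs from the indicator of [A] by
    at most the sum of the indicators of [U \ A] and [U \ C], both of small measure. *)
Lemma approximable_indic (A : set (Borel K)) : measurable A -> approximable \1_A.
Proof.
move=> mA; split=> // eps e0; have e2 : 0 < eps / 2 by rewrite divr_gt0.
have [U [oU AU] UA] := radon_outer rmu mA e2.
have [C [cC CU] CU'] := radon_inner hK rmu oU e2.
have [f [cf f01 f1 f0]] := urysohn_cutoff (R := R) cK hK (compact_closed hK cC) oU CU.
exists f => //.
have mU := open_measurable_Borel oU; have mC := compact_measurable_Borel hK cC.
have fin X : measurable X -> mu X \is a fin_num by exact: fin_num_measure.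
have mUA : measurable (U `\` A : set (Borel K)) by exact: measurableD.
have mUC : measurable (U `\` C : set (Borel K)) by exact: measurableD.
apply: (@le_lt_trans _ _ (\int[mu]_(x in [set: Borel K]) ((\1_(U `\` A) x)%:E + (\1_(U `\` C) x)%:E))%E).
  apply: ge0_le_integral => //.
  - by apply: measurable_dist => //; exact: continuous_measurable.
  - by apply: emeasurable_funD; exact/measurable_EFinP.
  move=> x _; rewrite -EFinD lee_fin.
  have iT (X : set K) : X x -> \1_X x = 1 :> R by move=> ?; rewrite indicE mem_set.
  have iF (X : set K) : ~ X x -> \1_X x = 0 :> R by move=> ?; rewrite indicE memNset.
  have /andP[fx0 fx1] := f01 x.
  have [Ux|Ux] := pselect (U x); last first.
    rewrite (iF A) ?f0 ?subr0 ?normr0 ?addr_ge0//.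
    by move=> /AU.
  have [Ax|Ax] := pselect (A x).
    rewrite (iT A)// (iF (U `\` A)) ?add0r; last by case.
    have [Cx|Cx] := pselect (C x); first by rewrite f1// subrr normr0 indicE.
    by rewrite (iT (U `\` C))// ger0_norm ?subr_ge0// lerBlDr lerDl.
  rewrite (iF A)// (iT (U `\` A))// sub0r normrN ger0_norm// (le_trans fx1)// lerDl.
  by rewrite indicE.
rewrite ge0_integralD//; try exact/measurable_EFinP.
rewrite !integral_indic// !setIT.
have mD (B : set (Borel K)) : measurable B -> B `<=` U -> mu (U `\` B) = (fine (mu U) - fine (mu B))%:E.
  move=> mB BU; rewrite measureD//; last by rewrite ltey_eq fin.
  by rewrite (setIidr BU) EFinB !fineK// fin.
have : ((fine (mu U) - fine (mu A))%:E + (fine (mu U) - fine (mu C))%:E < eps%:E)%E.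
  by rewrite -EFinD lte_fin; lra.
by rewrite -(mD A)// -(mD C).
Qed.

Lemma approximableD (f g : K -> R) : approximable f -> approximable g ->
  approximable (fun x => f x + g x).
Proof.
move=> [mf af] [mg ag]; split=> [|eps e0]; first exact: measurable_funD.
have e2 : 0 < eps / 2 by rewrite divr_gt0.
have [k ck fk] := af _ e2; have [l cl gl] := ag _ e2.
exists (fun x => k x + l x); first by move=> x; apply: cvgD; [exact: ck|exact: cl].
have [mk ml] := (continuous_measurable ck, continuous_measurable cl).
apply: (@le_lt_trans _ _ (\int[mu]_(x in [set: Borel K]) (`|f x - k x|%:E) + \int[mu]_(x in [set: Borel K]) (`|g x - l x|%:E))%E).
  rewrite -ge0_integralD//; try exact: measurable_dist.
  apply: ge0_le_integral => //.
  - by apply: measurable_dist; exact: measurable_funD.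
  - by apply: emeasurable_funD; exact: measurable_dist.
  - by move=> x _; rewrite -EFinD lee_fin opprD addrACA ler_normD.
by rewrite [eps]splitr EFinD; exact: lteD.
Qed.

Lemma approximableZ (c : R) (f : K -> R) : approximable f ->
  approximable (fun x => c * f x).
Proof.
move=> [mf af]; split=> [|eps e0]; first by apply: measurable_funM.
have c1 : 0 < `|c| + 1 by rewrite ltr_wpDl.
have [k ck fk] := af _ (divr_gt0 e0 c1).
exists (fun x => c * k x); first by move=> x; apply: cvgM; [exact: cvg_cst|exact: ck].
have mk := continuous_measurable ck.
under eq_integral do rewrite -mulrBr normrM EFinM.
rewrite ge0_integralZl_EFin//; last exact: measurable_dist.
apply: (@le_lt_trans _ _ ((`|c| + 1)%:E * \int[mu]_(x in [set: Borel K]) (`|f x - k x|%:E))%E).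
  by apply: lee_wpmul2r; [exact: integral_ge0|rewrite lee_fin lerDl].
by rewrite muleC -lte_pdivlMr.
Qed.

Lemma approximable_sum (I : Type) (s : seq I) (c : I -> R) (A : I -> set (Borel K)) :
  (forall i, measurable (A i)) ->
  approximable (fun x => \sum_(i <- s) c i * \1_(A i) x).
Proof.
move=> mA; elim: s => [|i s IH].
  under [X in approximable X]eq_fun do rewrite big_nil.
  have := approximableZ 0 (approximable_indic measurable0).
  by under [X in approximable X]eq_fun do rewrite mul0r.
under [X in approximable X]eq_fun do rewrite big_cons.
by apply: approximableD => //; apply: approximableZ; exact: approximable_indic.
Qed.

Import HBSimple.

Lemma integrable_approximable (f : K -> R) :
  mu.-integrable [set: Borel K] (EFin \o (f : Borel K -> R)) -> approximable f.
Proof.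
move=> intf; have mf := measurable_int mu intf.
have {}mf : measurable_fun [set: Borel K] (f : Borel K -> R) by exact/measurable_EFinP.
split=> // eps e0; have e2 : 0 < eps / 2 by rewrite divr_gt0.
have [g [ig _ gf]] := approximation_sfun_integrable measurableT intf.
have : \forall n \near \oo, (\int[mu]_(z in [set: Borel K]) `|(EFin \o f) z - (g n z)%:E| < (eps / 2)%:E)%E.
  have := gf; move=> /fine_cvgP[gfin] /cvgrPdist_lt/(_ _ e2).
  apply: filter_app; near=> n; move=> H.
  have fn : (\int[mu]_(z in [set: Borel K]) `|(EFin \o f) z - (g n z)%:E|)%E \is a fin_num.
    by near: n.
  rewrite -[X in (X < _)%E](fineK fn) lte_fin; move: H => /=; rewrite sub0r normrN => H.
  exact: le_lt_trans (ler_norm _) H.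
move=> [n _ /(_ n (leqnn n)) gn].
have [mg ag] : approximable (g n).
  have -> : (g n : K -> R) = (fun x => \sum_(y <- fset_set (range (g n))) y * \1_(g n @^-1` [set y]) x).
    by apply/funext => x; rewrite fimfunE fsbig_finite.
  by apply: approximable_sum.
have [k ck gk] := ag _ e2; exists k => //; have mk := continuous_measurable ck.
apply: le_lt_trans (L1_triangle mf mg mk) _.
by rewrite [eps]splitr EFinD; apply: lteD.
Unshelve. all: by end_near. Qed.

End Density.

(** * Averaging along a weakly continuous family of measures *)

Section MeasureBind.
Local Open Scope ereal_scope.
Context d1 d2 (Y : measurableType d1) (Z : measurableType d2) (R : realType).
Variables (l : {finite_measure set Y -> \bar R}) (k : Y -> {measure set Z -> \bar R}).
Hypotheses (mk : forall A, measurable A -> measurable_fun [set: Y] (k ^~ A))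
  (k1 : forall y, k y [set: Z] <= 1).

Let cstk (_ : unit) : {measure set Y -> \bar R} := l.
Let sndk (p : unit * Y) : {measure set Z -> \bar R} := k p.2.

Let cstk_measurable A : measurable A -> measurable_fun [set: unit] (cstk ^~ A).
Proof. by move=> _; exact: measurable_cst. Qed.

HB.instance Definition _ := isKernel.Build _ _ _ _ _ cstk cstk_measurable.

Let cstk_uub : measure_fam_uub cstk.
Proof.
exists (fine (l setT) + 1)%R => x; rewrite /cstk EFinD fineK ?fin_num_measure//.
by rewrite lteDl ?fin_num_measure// lte_fin.
Qed.

HB.instance Definition _ := Kernel_isFinite.Build _ _ _ _ _ cstk cstk_uub.

Let sndk_measurable A : measurable A -> measurable_fun [set: unit * Y] (sndk ^~ A).
Proof.
move=> mA; rewrite /sndk; apply: (measurableT_comp (mk mA)); exact: measurable_snd.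
Qed.

HB.instance Definition _ := isKernel.Build _ _ _ _ _ sndk sndk_measurable.

Let sndk_uub : measure_fam_uub sndk.
Proof. by exists 2%R => -[u y]; rewrite /sndk (le_lt_trans (k1 y))// lte_fin ltr1n. Qed.

HB.instance Definition _ := Kernel_isFinite.Build _ _ _ _ _ sndk sndk_uub.

(** Viewing [l] as a kernel from the one-point space makes this a composition of kernels, from which
    countable additivity and Tonelli follow. *)
Definition measure_bind : {measure set Z -> \bar R} := mkcomp cstk sndk tt.

Lemma measure_bindE A : measure_bind A = \int[l]_y k y A.
Proof. by []. Qed.

Lemma integral_measure_bind (f : Z -> \bar R) : (forall z, 0 <= f z) ->
  measurable_fun [set: Z] f ->
  \int[measure_bind]_z f z = \int[l]_y \int[k y]_z f z.
Proof. exact: (integral_kcomp cstk sndk tt). Qed.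

(** The positive and negative parts are dominated by the absolute value of [f], so their iterated
    integrals are finite and may be subtracted. *)
Lemma integrable_measure_bind (f : Z -> \bar R) :
  measure_bind.-integrable [set: Z] f ->
  \int[measure_bind]_z f z = \int[l]_y \int[k y]_z f z.
Proof.
move=> /integrableP[mf If].
have [mp mn] := (measurable_funepos mf, measurable_funeneg mf).
have mabs := measurableT_comp (@abse_measurable R setT) mf.
have absE := integral_measure_bind (fun z => abse_ge0 (f z)) mabs.
have fin (g : Z -> \bar R) : (forall z, 0 <= g z <= `|f z|) -> measurable_fun [set: Z] g ->
    l.-integrable [set: Y] (fun y => \int[k y]_z g z).
  move=> gf mg; have g0 z : 0 <= g z by have /andP[] := gf z.
  apply/integrableP; split; first exact: measurable_fun_integral_kernel.
  apply: le_lt_trans If; rewrite absE; apply: ge0_le_integral => //.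
  - by apply: measurableT_comp => //; exact: measurable_fun_integral_kernel.
  - exact: measurable_fun_integral_kernel.
  - move=> y _; rewrite gee0_abs ?integral_ge0//; apply: ge0_le_integral => //.
    by move=> z _; have /andP[] := gf z.
have fE z : `|f z| = f^\+ z + f^\- z := congr1 (fun g => g z) (fune_abse f).
rewrite integralE !integral_measure_bind// -integralB//.
- by apply: eq_integral => y _; rewrite [in RHS]integralE.
- by apply: fin => // z; rewrite fE funepos_ge0 leeDl.
- by apply: fin => // z; rewrite fE funeneg_ge0 leeDr.
Qed.

End MeasureBind.

Section BorelFamilies.
Context {R : realType} {K : ptopologicalType}.

(** Open sets are stable under intersection and generate the Borel sets; the sets [A] with
    measurable [t |-> k t A] form a Dynkin class, finite mass justifying the subtraction for
    complements. *)
Lemma measurable_Borel_family d (T : measurableType d)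
    (k : T -> {measure set (Borel K) -> \bar R}) :
  (forall t, k t setT < +oo)%E ->
  (forall U : set K, open U -> measurable_fun [set: T] (fun t => k t U)) ->
  forall A : set (Borel K), measurable A -> measurable_fun [set: T] (fun t => k t A).
Proof.
move=> kfin kU A mA.
apply: (@dynkin_induction _ (Borel K) (@open K)
  (fun A => measurable_fun [set: T] (fun t => k t A))) => //.
- exact: openI.
- by apply: kU; exact: openT.
- move=> S mS kS.
  have -> : (fun t => k t (~` S)) = (fun t => k t setT - k t S)%E.
    apply/funext => t; rewrite -setTD measureD// ?setTI//; exact: kfin.
  by apply: emeasurable_funB => //; apply: kU; exact: openT.
- move=> F mF tF kF.
  have -> : (fun t => k t (\bigcup_n F n)) = (fun t => \sum_(0 <= n <oo) k t (F n))%E.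
    apply/funext => t; rewrite measure_bigcup//.
    by apply: eq_eseriesl => n; rewrite in_setT.
  by apply: ge0_emeasurable_sum.
Qed.

End BorelFamilies.

(** * Continuous functions below the indicator of an open set *)

Section Cutoffs.
Context {R : realType} {K : ptopologicalType}.
Hypotheses (cK : compact [set: K]) (hK : hausdorff_space K).

Definition cutoffs (U : set K) : set (K -> R) :=
  [set f : K -> R | continuous f /\ forall x, 0 <= f x <= \1_U x].

Lemma cutoffs0 U : cutoffs U (cst 0).
Proof. by split=> x; [exact: cvg_cst|rewrite lexx indicE/=]. Qed.

Lemma cutoffs_max U f g : cutoffs U f -> cutoffs U g ->
  cutoffs U (fun x => Num.max (f x) (g x)).
Proof.
move=> [cf f0] [cg g0]; split=> x; last first.
  have [/andP[f1 f2] /andP[g1 g2]] := (f0 x, g0 x).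
  by rewrite le_max f1 ge_max f2 g2.
by apply: continuous_max; [exact: cf|exact: cg].
Qed.

Variable mu : {finite_measure set (Borel K) -> \bar R}.

Lemma le_continuous_Rintegral (f g : K -> R) : continuous f -> continuous g ->
  (forall x, f x <= g x) ->
  \int[mu]_(x in [set: Borel K]) f x <= \int[mu]_(x in [set: Borel K]) g x.
Proof.
move=> cf cg fg; apply: le_Rintegral => //; exact: continuous_integrable.
Qed.

Lemma cutoff_le U f : open U -> cutoffs U f ->
  \int[mu]_(x in [set: Borel K]) f x <= fine (mu U).
Proof.
move=> oU [cf f01]; have mU := open_measurable_Borel oU.
have -> : fine (mu U) = \int[mu]_(x in [set: Borel K]) \1_U x.
  by rewrite /Rintegral integral_indic// setIT.
apply: le_Rintegral => //; first exact: continuous_integrable.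
  apply: (@bounded_integrable _ _ mu _ 1) => // x.
  by rewrite indicE; case: (_ \in _); rewrite ?normr1 ?normr0.
by move=> x _; have /andP[] := f01 x.
Qed.

(** Inner regularity gives a compact [C] in [U] of measure above [a], and a Urysohn function between
    [C] and the complement of [U] integrates to at least the measure of [C]. *)
Lemma cutoff_sup U a : radon mu -> open U -> a < fine (mu U) ->
  exists2 f, cutoffs U f & a < \int[mu]_(x in [set: Borel K]) f x.
Proof.
move=> rmu oU aU; have e0 : 0 < fine (mu U) - a by rewrite subr_gt0.
have [C [cC CU]] := radon_inner hK rmu oU e0; rewrite subKr => aC.
have [f [cf f01 f1 f0]] := urysohn_cutoff (R := R) cK hK (compact_closed hK cC) oU CU.
exists f.
  split=> // x; have /andP[fx0 fx1] := f01 x; rewrite fx0/= indicE.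
  by have [_|/negP Ux] := boolP (x \in U) => //=; rewrite f0// => /mem_set.
have mC := compact_measurable_Borel hK cC.
apply: (lt_le_trans aC).
have -> : fine (mu C) = \int[mu]_(x in [set: Borel K]) \1_C x.
  by rewrite /Rintegral integral_indic// setIT.
apply: le_Rintegral => //; last 2 first.
- exact: continuous_integrable.
- move=> x _; rewrite indicE; have /andP[fx0 fx1] := f01 x.
  by have [/set_mem Cx|_] := boolP (x \in C) => //=; rewrite f1.
apply: (@bounded_integrable _ _ mu _ 1) => // x.
by rewrite indicE; case: (_ \in _); rewrite ?normr1 ?normr0.
Qed.

End Cutoffs.

(** * The Markov operator of a weakly continuous kernel and its contraction of [L^1] *)

Section InvariantKernel.
Context {R : realType} {K : ptopologicalType}.
Hypotheses (cK : compact [set: K]) (hK : hausdorff_space K).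
Variables (nu : K * K -> probability (Borel K) R) (sigma : probability (Borel K) R)
  (omega : {finite_measure set (Borel K) -> \bar R}).
Hypotheses (rnu : forall p, radon (nu p))
  (cnu : forall f : K -> R, continuous f ->
    continuous (fun p => \int[nu p]_(w in [set: Borel K]) f w))
  (rsigma : radon sigma) (romega : radon omega).

(** For [nu (y, x) = conv (inv y) x] this is the convolution [sigma * f]. *)
Definition markov_op (f : K -> R) (x : K) : R :=
  \int[sigma]_(y in [set: Borel K]) \int[nu (y, x)]_(w in [set: Borel K]) f w.

Lemma continuous_nul (f : K -> R) x : continuous f ->
  continuous (fun y => \int[nu (y, x)]_(w in [set: Borel K]) f w).
Proof.
move=> cf; apply: (continuous_comp2 (cnu cf)) => y; [exact: cvg_id|exact: cvg_cst].
Qed.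

Lemma continuous_markov (f : K -> R) : continuous f -> continuous (markov_op f).
Proof.
move=> cf; apply: (@cvg_continuous_Rintegral _ _ cK _ (fun=> sigma) 1 
  (fun p => \int[nu p]_(w in [set: Borel K]) f w)).
- by move=> _; have -> : fine (sigma setT) = 1 by rewrite probability_setT.
- by move=> g _ x; exact: cvg_cst.
- exact: cnu.
Qed.

(** Lower semicontinuity: the mass of [U] is the supremum of the integrals of its cutoffs, each of
    them continuous in [y]. *)
Lemma open_nuU U x a : open U -> open [set y | a < fine (nu (y, x) U)].
Proof.
move=> oU.
have -> : [set y | a < fine (nu (y, x) U)] =
    \bigcup_(f in cutoffs U) [set y | a < \int[nu (y, x)]_(w in [set: Borel K]) f w].
  apply/seteqP; split=> [y /= /(cutoff_sup cK hK (rnu (y, x)) oU)[f]|y [f Uf] /= af].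
    by exists f.
  exact: lt_le_trans (cutoff_le cK _ oU Uf).
by apply: bigcup_open => f [cf _]; exact/continuous_open_gt/continuous_nul.
Qed.

Lemma measurable_nu x (A : set (Borel K)) : measurable A ->
  measurable_fun [set: Borel K] (fun y : Borel K => nu (y, x) A).
Proof.
apply: measurable_Borel_family => [y|U oU]; first by rewrite ltey_eq fin_num_measure.
have -> : (fun y : Borel K => nu (y, x) U) = EFin \o (fun y => fine (nu (y, x) U)).
  by apply/funext => y /=; rewrite fineK// fin_num_measure//; exact: open_measurable_Borel.
by apply/measurable_EFinP; apply: lsc_measurable => a; exact: open_nuU.
Qed.

Lemma nu_le1 x y : (nu (y, x) setT <= 1)%E.
Proof. by rewrite probability_setT. Qed.

(** The one-step transition law from [x]. With [x] fixed, measurability in [y] alone makes it well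
    defined. *)
Definition mixture (x : K) : {measure set (Borel K) -> \bar R} :=
  measure_bind sigma (@measurable_nu x).

Lemma mixture_openE x U : open U ->
  fine (mixture x U) = \int[sigma]_(y in [set: Borel K]) fine (nu (y, x) U).
Proof.
move=> oU; rewrite measure_bindE /Rintegral; congr fine.
by apply: eq_integral => y _; rewrite fineK// fin_num_measure//; exact: open_measurable_Borel.
Qed.

Lemma mixture_setT x : mixture x setT = 1%E.
Proof.
rewrite measure_bindE; transitivity (\int[sigma]_(y in [set: Borel K]) 1)%E.
  by apply: eq_integral => y _; exact: probability_setT.
by rewrite integral_cst// mul1e; exact: probability_setT.
Qed.

Lemma le_mixture x (A B : set (Borel K)) : measurable A -> measurable B -> A `<=` B -> (mixture x A <= mixture x B)%E.
Proof. by move=> mA mB AB; apply: le_measure => //; exact: mem_set. Qed.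

Lemma mixture_fin x (A : set (Borel K)) : measurable A -> mixture x A \is a fin_num.
Proof.
move=> mA; rewrite ge0_fin_numE//.
by rewrite (le_lt_trans (le_mixture x mA measurableT (@subsetT _ _)))// mixture_setT ltry.
Qed.

Lemma nuU_bounds x y U : open U -> 0 <= fine (nu (y, x) U) <= 1.
Proof.
move=> oU; rewrite fine_ge0//= -lee_fin fineK ?probability_le1//.
  exact: open_measurable_Borel.
by apply: fin_num_measure; exact: open_measurable_Borel.
Qed.

(** The integrals of cutoffs, as functions of [y], form a directed family of continuous functions
    with supremum the mass of [U]. Tau-additivity of [sigma], in the form [radon_directed_sup],
    exchanges this supremum with the integral. *)
Lemma mixture_sup x U a : open U -> a < fine (mixture x U) ->
  exists2 f, cutoffs U f & a < markov_op f x.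
Proof.
move=> oU; rewrite mixture_openE// => aU.
pose D := [set g | exists2 f, cutoffs U f &
  g = (fun y => \int[nu (y, x)]_(w in [set: Borel K]) f w)].
have [||||||g [f Uf ->] af] := @radon_directed_sup _ _ cK hK sigma D
  (fun y => \int[nu (y, x)]_(w in [set: Borel K]) cst 0 w) _ _ _
  (fun y => fine (nu (y, x) U)) a rsigma _ _ _ aU; last by exists f.
- by exists (cst 0) => //; exact: cutoffs0.
- move=> _ _ [f Uf ->] [g Ug ->].
  have Ufg := cutoffs_max Uf Ug.
  exists (fun y => \int[nu (y, x)]_(w in [set: Borel K]) Num.max (f w) (g w)).
    by exists (fun w => Num.max (f w) (g w)).
  move=> y; split; apply: le_continuous_Rintegral => //; try by case: Uf Ug Ufg => [? _] [? _] [].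
  + by move=> w; rewrite le_max lexx.
  + by move=> w; rewrite le_max lexx orbT.
- by move=> _ [f [cf _] ->]; exact: continuous_nul.
- move=> _ y [f Uf ->]; rewrite (cutoff_le cK _ oU Uf) andbT.
  by apply: Rintegral_ge0 => w _; have [_ /(_ w)/andP[]] := Uf.
- by move=> y; have /andP[] := nuU_bounds x y oU.
- move=> y b /(cutoff_sup cK hK (rnu (y, x)) oU)[f Uf bf].
  by exists (fun y => \int[nu (y, x)]_(w in [set: Borel K]) f w) => //; exists f.
Qed.

Lemma mixture_ge x U f : open U -> cutoffs U f -> markov_op f x <= fine (mixture x U).
Proof.
move=> oU Uf; rewrite mixture_openE//; apply: le_Rintegral => //.
- by apply: continuous_integrable => //; apply: continuous_nul; case: Uf.
- apply: (@bounded_integrable _ _ sigma _ 1).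
    by apply: lsc_measurable => a; exact: open_nuU.
  by move=> y; have /andP[? ?] := nuU_bounds x y oU; rewrite ger0_norm.
- by move=> y _; exact: cutoff_le.
Qed.

Lemma open_mixture U a : open U -> open [set x | a < fine (mixture x U)].
Proof.
move=> oU.
have -> : [set x | a < fine (mixture x U)] = \bigcup_(f in cutoffs U) [set x | a < markov_op f x].
  apply/seteqP; split=> [x /= /(mixture_sup oU)[f]|x [f Uf] /= af]; first by exists f.
  exact: lt_le_trans (mixture_ge _ oU Uf).
by apply: bigcup_open => f [cf _]; exact/continuous_open_gt/continuous_markov.
Qed.

Lemma measurable_mixture (A : set (Borel K)) : measurable A ->
  measurable_fun [set: Borel K] (fun x : Borel K => mixture x A).
Proof.
apply: measurable_Borel_family => [y|U oU]; first by rewrite ltey_eq mixture_fin.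
have -> : (fun y : Borel K => mixture y U) = EFin \o (fun y => fine (mixture y U)).
  by apply/funext => y /=; rewrite fineK// mixture_fin//; exact: open_measurable_Borel.
by apply/measurable_EFinP; apply: lsc_measurable => a; exact: open_mixture.
Qed.

Lemma mixture_le1 x : (mixture x setT <= 1)%E.
Proof. by rewrite mixture_setT. Qed.

Hypothesis inv_omega : forall f : K -> R, continuous f ->
  \int[omega]_(x in [set: Borel K]) markov_op f x = \int[omega]_(x in [set: Borel K]) f x.

(** The law after one step started from [omega]. Invariance is given on continuous functions; the
    aim is equality with [omega] on Borel sets. *)
Definition averaged : {measure set (Borel K) -> \bar R} :=
  measure_bind omega measurable_mixture.

Lemma averaged_openE U : open U ->
  fine (averaged U) = \int[omega]_(x in [set: Borel K]) fine (mixture x U).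
Proof.
move=> oU; rewrite measure_bindE /Rintegral; congr fine.
by apply: eq_integral => y _; rewrite fineK// mixture_fin//; exact: open_measurable_Borel.
Qed.

Lemma averaged_fin (A : set (Borel K)) : measurable A -> averaged A \is a fin_num.
Proof.
move=> mA; rewrite ge0_fin_numE// measure_bindE.
apply: (@le_lt_trans _ _ (\int[omega]_(x in [set: Borel K]) 1)%E).
  apply: ge0_le_integral => //; first exact: measurable_mixture.
  by move=> x _; rewrite -(mixture_setT x); exact: le_mixture.
by rewrite integral_cst// mul1e ltey_eq fin_num_measure.
Qed.

Lemma mixture_integrable U : open U ->
  omega.-integrable [set: Borel K] (EFin \o (fun x : Borel K => fine (mixture x U))).
Proof.
move=> oU; apply: (@bounded_integrable _ _ omega _ 1).
  by apply: lsc_measurable => a; exact: open_mixture.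
move=> x; rewrite ger0_norm ?fine_ge0// -lee_fin fineK.
  by rewrite -(mixture_setT x); apply: le_mixture => //; exact: open_measurable_Borel.
by apply: mixture_fin; exact: open_measurable_Borel.
Qed.

(** If [averaged U] exceeded [omega U], tau-additivity of [omega] would give a cutoff [f] with the
    integral of [markov_op f] above [omega U]; if it were smaller, some cutoff would have integral
    above [averaged U]. Invariance on continuous functions excludes both. *)
Lemma averaged_open U : open U -> fine (averaged U) = fine (omega U).
Proof.
move=> oU; rewrite averaged_openE//; apply/eqP; rewrite eq_le; apply/andP; split.
- rewrite leNgt; apply/negP => cU.
  pose D := [set g | exists2 f, cutoffs U f & g = markov_op f].
  have [||||||g [f Uf ->] cf] := @radon_directed_sup _ _ cK hK omega D
    (markov_op (cst 0)) _ _ _ (fun x => fine (mixture x U)) _ romega _ _ _ cU.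
  + by exists (cst 0) => //; exact: cutoffs0.
  + move=> _ _ [f Uf ->] [g Ug ->].
    have Ufg := cutoffs_max Uf Ug.
    exists (markov_op (fun w => Num.max (f w) (g w))).
      by exists (fun w => Num.max (f w) (g w)).
    have cf : continuous f by case: Uf.
    have cg : continuous g by case: Ug.
    have cfg : continuous (fun w => Num.max (f w) (g w)) by case: Ufg.
    move=> x; split; (apply: le_continuous_Rintegral => //; first exact: continuous_nul;
      first exact: continuous_nul) => y; apply: le_continuous_Rintegral => // w.
    * by rewrite le_max lexx.
    * by rewrite le_max lexx orbT.
  + by move=> _ [f [cf _] ->]; exact: continuous_markov.
  + move=> _ x [f Uf ->]; rewrite (mixture_ge x oU Uf) andbT.
    apply: Rintegral_ge0 => y _; apply: Rintegral_ge0 => w _.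
    by have [_ /(_ w)/andP[]] := Uf.
  + move=> x; rewrite -lee_fin fineK.
      by rewrite -(mixture_setT x); apply: le_mixture => //; exact: open_measurable_Borel.
    by apply: mixture_fin; exact: open_measurable_Borel.
  + move=> x b /(mixture_sup oU)[f Uf bf].
    by exists (markov_op f) => //; exists f.
  move: cf; rewrite inv_omega; last by case: Uf.
  by rewrite ltNge => /negP; apply; exact: cutoff_le.
- rewrite leNgt; apply/negP => /(cutoff_sup cK hK romega oU)[f Uf cf].
  rewrite -(@inv_omega f) in cf; last by case: Uf.
  move: cf; rewrite ltNge => /negP; apply; apply: le_Rintegral => //.
  + by apply: continuous_integrable => //; apply: continuous_markov; case: Uf.
  + exact: mixture_integrable.
  + by move=> x _; exact: mixture_ge.
Qed.

Lemma averagedE (A : set (Borel K)) : measurable A -> averaged A = omega A.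
Proof.
move=> mA; apply: (@measure_unique _ R (Borel K) (@open K) (fun=> setT) _ _ _ _ averaged omega) => //.
- exact: openI.
- by move=> _; exact: openT.
- by rewrite bigcup_const.
- move=> U oU; have mU := open_measurable_Borel oU.
  by rewrite -[LHS]fineK ?averaged_fin// averaged_open// fineK// fin_num_measure.
- by move=> _; rewrite ltey_eq averaged_fin.
Qed.

Lemma integral_averaged (f : Borel K -> \bar R) : (forall x, 0 <= f x)%E ->
  measurable_fun [set: Borel K] f ->
  (\int[omega]_(x in [set: Borel K]) \int[mixture x]_(w in [set: Borel K]) f w =
   \int[omega]_(x in [set: Borel K]) f x)%E.
Proof.
move=> f0 mf; rewrite -(integral_measure_bind omega measurable_mixture mixture_le1)//.
by apply: eq_measure_integral => A mA _; exact: averagedE.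
Qed.

Lemma integral_mixture x (f : Borel K -> \bar R) :
  (mixture x).-integrable [set: Borel K] f ->
  (\int[mixture x]_(w in [set: Borel K]) f w = \int[sigma]_(y in [set: Borel K])
     \int[nu (y, x)]_(w in [set: Borel K]) f w)%E.
Proof.
exact: (@integrable_measure_bind _ _ _ _ _ sigma _ (@measurable_nu x) (nu_le1 x) f).
Qed.

Lemma markovE (f : K -> R) x : continuous f ->
  (\int[mixture x]_(w in [set: Borel K]) (f w)%:E = (markov_op f x)%:E)%E.
Proof.
move=> cf; rewrite integral_mixture.
  rewrite /markov_op -continuous_integralE//; last exact: continuous_nul.
  by apply: eq_integral => y _; rewrite continuous_integralE.
have [M _ fM] := continuous_bound cK cf.
apply: (@measurable_bounded_integrable _ _ _ (mixture x) f) => //.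
- by rewrite ltey_eq mixture_fin.
- exact: continuous_measurable.
- exists M; split; first exact: num_real.
  by move=> r Mr y _; exact: le_trans (fM y) (ltW Mr).
Qed.

(** Where [u] is harmonic, the distance from [u x] to [markov_op k x] is at most the integral of the
    distance from [u] to [k] against [mixture x]. Integrating over [omega] and applying
    [integral_averaged] gives the contraction. *)
Lemma markov_L1 (u k : K -> R) (eps : R) :
  measurable_fun [set: Borel K] (u : Borel K -> R) -> continuous k ->
  {ae omega, forall x : Borel K, (\int[sigma]_(y in [set: Borel K])
     \int[nu (y, x)]_(w in [set: Borel K]) (u w)%:E = (u x)%:E)%E} ->
  (\int[omega]_(x in [set: Borel K]) `|u x - k x|%:E <= eps%:E)%E ->
  (\int[omega]_(x in [set: Borel K]) `|u x - markov_op k x|%:E <= eps%:E)%E.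
Proof.
move=> mu ck hu uk; have mk := continuous_measurable ck.
have md := measurable_dist mu mk.
rewrite -(integral_averaged _ md) ?lee_fin// in uk.
pose D (x : Borel K) := (\int[mixture x]_(w in [set: Borel K]) `|u w - k w|%:E)%E.
have mD : measurable_fun [set: Borel K] D.
  exact: (measurable_fun_integral_kernel measurable_mixture).
have iD : omega.-integrable [set: Borel K] D.
  apply/integrableP; split=> //; apply: le_lt_trans (ltry eps); apply: le_trans uk.
  apply: ge0_le_integral => //; first exact: measurableT_comp.
  by move=> x _; rewrite gee0_abs// integral_ge0.
apply: le_trans uk; apply: ae_ge0_le_integral => //.
- by apply: measurable_dist => //; apply: continuous_measurable; exact: continuous_markov.
- by move=> x _; exact: integral_ge0.
(* For almost every [x] the value [D x] is finite. There [u] is integrable for [mixture x], so the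
   harmonic equation can be read as an integral against [mixture x]. *)
have := integrable_ae measurableT iD; apply: filterS2 hu => x hu Dx _.
have {}Dx := Dx I.
have imD : (mixture x).-integrable [set: Borel K] (EFin \o (fun w => u w - k w)).
  apply/integrableP; split; first by apply/measurable_EFinP; exact: measurable_funB.
  by have := ltey_eq (D x); rewrite Dx.
have imk : (mixture x).-integrable [set: Borel K] (EFin \o (k : Borel K -> R)).
  have [M _ fM] := continuous_bound cK ck.
  apply: (@measurable_bounded_integrable _ _ _ (mixture x) k) => //.
    by rewrite ltey_eq mixture_fin.
  exists M; split; first exact: num_real.
  by move=> r Mr y _; exact: le_trans (fM y) (ltW Mr).
have imu : (mixture x).-integrable [set: Borel K] (EFin \o (u : Borel K -> R)).
  have -> : EFin \o (u : Borel K -> R) = ((EFin \o (fun w => (u w - k w)%R)) \+ (EFin \o k))%E.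
    by apply/funext => w /=; rewrite -EFinD subrK.
  exact: integrableD.
have -> : (`|u x - markov_op k x|%:E = `|(u x)%:E - (markov_op k x)%:E|)%E by [].
rewrite -hu -(integral_mixture imu) -markovE//.
rewrite -integralB//; apply: le_trans (le_abse_integral _ _ _) _ => //.
by apply/measurable_EFinP; exact: measurable_funB.
Qed.

End InvariantKernel.

Local Notation II mu f := (Rintegral mu [set: Borel _] f).

Lemma open_localP (T : topologicalType) (A : set T) :
  (forall z, A z -> exists2 U : set T, open U /\ U z & U `<=` A) -> open A.
Proof.
move=> H; rewrite openE => z /H[U oUz UA].
by apply: (filterS UA); exact: open_nbhs_nbhs.
Qed.

(** * Supports *)

Section Supports.
Context {R : realType} {K : ptopologicalType}.
Hypotheses (cK : compact [set: K]) (hK : hausdorff_space K).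
Variable mu : {finite_measure set (Borel K) -> \bar R}.

Lemma msupp_closed : closed (msupp mu).
Proof.
suff : open (~` msupp mu) by move=> /open_closedC; rewrite setCK.
apply: open_localP => z /existsNP[U] /not_implyP[oU] /not_implyP[Uz] mU.
by exists U => // y Uy /(_ U oU Uy).
Qed.

(** The open neighbourhood of [z] where [f] exceeds half of [f z] has positive measure. *)
Lemma msupp_Rintegral_gt0 (f : K -> R) z : continuous f -> (forall x, 0 <= f x) ->
  msupp mu z -> 0 < f z -> 0 < II mu f.
Proof.
move=> cf f0 sz fz; have f2 : 0 < f z / 2 by rewrite divr_gt0.
pose U := [set x | f z / 2 < f x].
have oU : open U by exact: continuous_open_gt.
have mU := open_measurable_Borel oU.
have : 0 < f z / 2 * fine (mu U).
  rewrite mulr_gt0// fine_gt0// sz//=; last by rewrite /U/= ltr_pdivrMr// ltr_pMr// ltr1n.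
  by rewrite ltey_eq fin_num_measure.
move=> /lt_le_trans; apply.
have -> : fine (mu U) = II mu (\1_U : Borel K -> R) by rewrite /Rintegral integral_indic// setIT.
have iU : mu.-integrable setT (EFin \o (\1_U : Borel K -> R)).
  apply: (@bounded_integrable _ _ mu _ 1) => // x.
  by rewrite indicE; case: (_ \in _); rewrite ?normr1 ?normr0.
rewrite -RintegralZl//; apply: le_Rintegral => //.
- exact: (integrableZl _ _ iU).
- exact: continuous_integrable.
move=> x _; rewrite /=; have [/set_mem Ux|_] := boolP (x \in U) => /=.
  by rewrite mulr1 ltW.
by rewrite mulr0.
Qed.

Lemma msupp_Rintegral_eq0 (f : K -> R) z : continuous f -> (forall x, 0 <= f x) ->
  II mu f = 0 -> msupp mu z -> f z = 0.
Proof.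
move=> cf f0 If sz; apply/eqP; rewrite eq_le f0 andbT leNgt; apply/negP => fz.
by have := msupp_Rintegral_gt0 cf f0 sz fz; rewrite If ltxx.
Qed.

Hypothesis rmu : radon mu.

(** Otherwise inner regularity gives a compact subset of [U] of positive measure; each of its points
    has a null open neighbourhood, and finitely many of these cover it. *)
Lemma disjoint_msupp (U : set K) : open U -> U `&` msupp mu = set0 -> fine (mu U) = 0.
Proof.
move=> oU US; apply/eqP; rewrite eq_le fine_ge0// andbT leNgt; apply/negP => U0.
(* The tolerance is the whole mass of [U], so the lower bound on the mass of [C] becomes 0. *)
have [C [cC CU]] := radon_inner hK rmu oU U0; rewrite subrr => C0.
have /choice[V VP] (x : K) : exists V : set K, C x -> [/\ open V, V x & mu V = 0%E].
  have [Cx|nCx] := pselect (C x); last by exists set0.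
  have : ~ msupp mu x.
    by move=> sx; have := conj (CU x Cx) sx; rewrite -[_ /\ _]/((U `&` msupp mu) x) US.
  move=> /existsNP[V] /not_implyP[oV] /not_implyP[Vx] /negP mV; exists V => _.
  by split => //; apply/eqP; rewrite eq_le measure_ge0 andbT leNgt.
have := cC; rewrite compact_cover => /(_ _ C V) [].
- by move=> x /VP[].
- by move=> x Cx; exists x => //; have [] := VP x Cx.
move=> E EC CE.
have neg (s : seq K) : (forall x, x \in s -> C x) ->
    mu.-negligible (\bigcup_(x in [set x | x \in s]) V x : set (Borel K)).
  elim: s => [_|x s IH sC].
    by apply: (@negligibleS _ _ _ mu set0); [move=> y []|exact: negligible_set0].
  apply: (@negligibleS _ _ _ mu (V x `|` \bigcup_(x in [set x | x \in s]) V x)).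
    move=> y [z /=]; rewrite inE => /orP[/eqP->|zs] Vy; first by left.
    by right; exists z.
  apply: negligibleU; last by apply: IH => z zs; apply: sC; rewrite inE zs orbT.
  have [oV _ V0] := VP x (sC _ (mem_head _ _)).
  by apply/negligibleP => //; exact: open_measurable_Borel.
have mC := compact_measurable_Borel hK cC.
have : mu.-negligible (C : set (Borel K)).
  by apply: negligibleS (neg (enum_fset E) _) => // x /EC/set_mem.
by move=> /negligibleP => /(_ mC) mC0; move: C0; rewrite mC0/= ltxx.
Qed.

(** Scaled below 1, [f] is a cutoff of the open set where it is positive, and that set misses the
    support. *)
Lemma msupp_Rintegral0 (f : K -> R) : continuous f -> (forall x, 0 <= f x) ->
  (forall x, msupp mu x -> f x = 0) -> II mu f = 0.
Proof.
move=> cf f0 fs; have [M M0 fM] := continuous_bound cK cf.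
have M1 : 0 < M + 1 by rewrite ltr_wpDl.
pose U := [set x | 0 < f x].
have oU : open U by exact: continuous_open_gt.
have U0 : fine (mu U) = 0.
  apply: disjoint_msupp => //; rewrite -subset0 => x [/= fx /fs fx0].
  by move: fx; rewrite /U/= fx0 ltxx.
have : II mu (fun x => (M + 1)^-1 * f x) <= fine (mu U).
  apply: cutoff_le => //; split.
    by move=> x; apply: cvgM; [exact: cvg_cst|exact: cf].
  move=> x; rewrite mulr_ge0 ?invr_ge0 ?(ltW M1)//= indicE.
  have [_|/negP Ux] := boolP (x \in U) => /=.
    rewrite mulrC ler_pdivrMr// mul1r (le_trans (ler_norm _))// (le_trans (fM x))//.
    by rewrite lerDl.
  have -> : f x = 0; last by rewrite mulr0.
  apply/eqP; rewrite eq_le f0 andbT leNgt; apply/negP => fx; apply: Ux; exact: mem_set.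
rewrite RintegralZl//; last exact: continuous_integrable.
rewrite U0 pmulr_rle0 ?invr_gt0// => If.
by apply/eqP; rewrite eq_le If; apply: Rintegral_ge0.
Qed.

End Supports.

(** * Continuous harmonic functions *)

Section Rigidity.
Context {R : realType} {K : ptopologicalType}.
Hypotheses (cK : compact [set: K]) (hK : hausdorff_space K).
Variables (conv : K -> K -> probability (Borel K) R) (e : K) (inv : K -> K).
Variables (omega : {finite_measure set (Borel K) -> \bar R})
  (sigma : probability (Borel K) R).
Hypotheses (rconv : forall x y, radon (conv x y))
  (convA : forall x y z (f : K -> R), continuous f ->
    II (conv x y) (fun u => II (conv u z) f) = II (conv y z) (fun v => II (conv x v) f))
  (cconv : forall f : K -> R, continuous f ->
    continuous (fun xy : K * K => II (conv xy.1 xy.2) f))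
  (usc : forall U : set K, open U ->
    open [set xy : K * K | msupp (conv xy.1 xy.2) `<=` U])
  (conve : forall x (f : K -> R), continuous f ->
    II (conv e x) f = f x /\ II (conv x e) f = f x)
  (cinv : continuous inv) (invK : involutive inv)
  (conv_inv : forall x y (f : K -> R), continuous f ->
    II (conv x y) (fun w => f (inv w)) = II (conv (inv y) (inv x)) f)
  (supp_e : forall x y, msupp (conv x y) e <-> x = inv y)
  (romega : radon omega) (omega_gt0 : 0 < fine (omega setT))
  (haar : forall x (f : K -> R), continuous f ->
    II omega (fun y => II (conv x y) f) = II omega f).

Lemma continuous_convr (f : K -> R) x : continuous f ->
  continuous (fun y => II (conv x y) f).
Proof.
by move=> cf; apply: (continuous_comp2 (cconv cf)) => y; [exact: cvg_cst|exact: cvg_id].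
Qed.

Lemma continuous_convl (f : K -> R) y : continuous f ->
  continuous (fun x => II (conv x y) f).
Proof.
by move=> cf; apply: (continuous_comp2 (cconv cf)) => x; [exact: cvg_id|exact: cvg_cst].
Qed.

Lemma conv_ge0 (f : K -> R) x y : (forall w, 0 <= f w) -> 0 <= II (conv x y) f.
Proof. by move=> f0; apply: Rintegral_ge0. Qed.

(** Fix [y0] in the support of [omega]. By left invariance the function [y |-> II (conv z y) f] has
    integral 0, so it vanishes at [y0], for every [z]. By associativity [f] then integrates to 0
    over [x * (inv y0 * y0)], and [e] lies in the support of [inv y0 * y0], whence [f x = 0]. *)
Lemma haar_faithful (f : K -> R) x : continuous f -> (forall w, 0 <= f w) ->
  II omega f = 0 -> f x = 0.
Proof.
move=> cf f0 If.
have [y0 sy0] : exists y, msupp omega y.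
  apply: contrapT => /forallNP no; have := omega_gt0.
  rewrite (disjoint_msupp hK romega openT) ?ltxx// setTI.
  by rewrite -subset0 => y /no.
have fy0 z : II (conv z y0) f = 0.
  apply: (@msupp_Rintegral_eq0 _ _ cK omega (fun y => II (conv z y) f)) => //.
  - exact: continuous_convr.
  - by move=> y; exact: conv_ge0.
  - by rewrite haar.
have := convA x (inv y0) y0 cf.
under [X in X = _ -> _]eq_Rintegral do rewrite fy0.
rewrite cst_Rintegral mul0r => /esym H.
have [_ <-] := conve x cf.
apply: (@msupp_Rintegral_eq0 _ _ cK (conv (inv y0) y0) (fun v => II (conv x v) f)) => //.
- exact: continuous_convr.
- by move=> y; exact: conv_ge0.
- exact/supp_e.
Qed.

Let nu (p : K * K) : probability (Borel K) R := conv (inv p.1) p.2.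
Local Notation P := (markov_op nu sigma).

Lemma nu_continuous (f : K -> R) : continuous f -> continuous (fun p => II (nu p) f).
Proof.
move=> cf; apply: (continuous_comp2 (cconv cf)) => p; last exact: cvg_snd.
by apply: (@continuous_comp _ _ _ fst inv); [exact: cvg_fst|exact: cinv].
Qed.

Lemma markov_invariant (f : K -> R) : continuous f ->
  II omega (P f) = II omega f.
Proof.
move=> cf; rewrite /markov_op.
rewrite (@Fubini_continuous _ _ cK omega sigma (fun p => II (nu (p.2, p.1)) f)); last first.
  by apply: (continuous_comp2 (nu_continuous cf)) => p; [exact: cvg_snd|exact: cvg_fst].
transitivity (II sigma (fun=> II omega f)).
  by apply: eq_Rintegral => y _; rewrite /nu/=; exact: (haar (inv y) cf).
rewrite cst_Rintegral (_ : fine (sigma setT) = 1) ?mulr1//.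
by rewrite probability_setT.
Qed.

(** * Mean square deviation and the rigid set of a continuous function *)

Section Harmonic.
Variable h : K -> R.
Hypothesis ch : continuous h.

(** The mean square deviation of [h] from [h x] under [conv a x]; it vanishes exactly when [h]
    equals [h x] on the support of [conv a x]. *)
Definition spread a x := II (conv a x) (fun w => (h w - h x) * (h w - h x)).

Lemma continuous_sqr_dist c : continuous (fun w => (h w - c) * (h w - c)).
Proof.
by move=> w; apply: cvgM; apply: cvgB; (exact: ch || exact: cvg_cst).
Qed.

Lemma spreadE a x : spread a x =
  II (conv a x) (fun w => h w * h w) - (2 * h x) * II (conv a x) h + h x * h x.
Proof.
have ch2 : continuous (fun w => h w * h w) by move=> w; apply: cvgM; exact: ch.
have chx : continuous (fun w => 2 * h x * h w).
  by move=> w; apply: cvgM; [exact: cvg_cst|exact: ch].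
have i1 := continuous_integrable cK (conv a x) ch2.
have i2 := continuous_integrable cK (conv a x) chx.
have i3 := continuous_integrable cK (conv a x) ch.
rewrite -RintegralZl// -RintegralB//.
have -> : h x * h x = II (conv a x) (fun=> h x * h x).
  by rewrite cst_Rintegral (_ : fine _ = 1) ?mulr1//= probability_setT.
rewrite -RintegralD//; first by apply: eq_Rintegral => w _; ring.
- apply: (@continuous_integrable _ _ cK (conv a x) (fun w => h w * h w - 2 * h x * h w)).
  by move=> w; apply: cvgB; [exact: ch2|exact: chx].
- exact: finite_measure_integrable_cst.
Qed.

Lemma spread_ge0 a x : 0 <= spread a x.
Proof. by apply: conv_ge0 => w; rewrite -expr2 sqr_ge0. Qed.

Lemma continuous_spread x : continuous (fun a => spread a x).
Proof. by apply: continuous_convl; exact: continuous_sqr_dist. Qed.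

Definition rigid : set K := [set a | forall x, spread a x = 0].

(** By associativity, translating by [a * b] is translating by [b] and then by [a]. With [(h w - h
    x)^2 <= 2 (h w - h v)^2 + 2 (h v - h x)^2], the integral of [spread c x] over [conv a b] is 0,
    so the spread vanishes on the support. *)
Lemma rigid_conv a b c : rigid a -> rigid b -> msupp (conv a b) c -> rigid c.
Proof.
move=> ra rb sc x; have cg := @continuous_sqr_dist (h x).
apply: (@msupp_Rintegral_eq0 _ _ cK (conv a b) (fun c => spread c x)) => //.
- exact: continuous_spread.
- by move=> z; exact: spread_ge0.
rewrite /spread convA//.
have le v : II (conv a v) (fun w => (h w - h x) * (h w - h x)) <=
    2 * ((h v - h x) * (h v - h x)).
  have cv := @continuous_sqr_dist (h v).
  have iv := continuous_integrable cK (conv a v) cv.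
  pose q w := 2 * ((h w - h v) * (h w - h v)) + 2 * ((h v - h x) * (h v - h x)).
  have cq1 : continuous (fun w => 2 * ((h w - h v) * (h w - h v))).
    by move=> w; apply: cvgM; [exact: cvg_cst|exact: cv].
  have cq : continuous q by move=> w; apply: cvgD; [exact: cq1|exact: cvg_cst].
  apply: (@le_trans _ _ (II (conv a v) q)).
    apply: le_continuous_Rintegral => // w.
    rewrite /q -subr_ge0.
    rewrite (_ : _ - _ = (h w - 2 * h v + h x) ^+ 2); last by ring.
    exact: sqr_ge0.
  rewrite RintegralD//; last 2 first.
  - exact: continuous_integrable.
  - exact: finite_measure_integrable_cst.
  rewrite RintegralZl// cst_Rintegral -[X in 2 * X + _]/(spread a v) ra mulr0 add0r.
  by rewrite (_ : fine _ = 1) ?mulr1//= probability_setT.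
apply/eqP; rewrite eq_le; apply/andP; split; last first.
  by apply: Rintegral_ge0 => v _; apply: conv_ge0 => w; rewrite -expr2 sqr_ge0.
apply: (@le_trans _ _ (II (conv b x) (fun v => 2 * ((h v - h x) * (h v - h x))))).
  apply: le_continuous_Rintegral => //; first exact: continuous_convr.
  by move=> v; apply: cvgM; [exact: cvg_cst|exact: cg].
rewrite RintegralZl//; last exact: continuous_integrable.
by rewrite -[X in 2 * X]/(spread b x) rb mulr0.
Qed.

(** For [u] in [C] the support of [conv u x] misses [e], because [u] is not [inv x]. A Urysohn
    function separates the two, upper semicontinuity of supports preserves this for nearby [u], and
    compactness of [C] gives one [W] for all [u]. *)
Lemma msupp_avoid x (C : set K) : closed C -> ~ C (inv x) ->
  exists2 W : set K, open W /\ W e & forall u, C u -> W `&` msupp (conv u x) = set0.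
Proof.
move=> cC Cx.
have cptC : compact C by exact: subclosed_compact cC cK _.
have [cov _] := compact_near_coveringP C.
have : \forall i \near e, C `<=` (fun u => ~ msupp (conv u x) i).
  apply: (cov cptC K (nbhs e) (fun i u => ~ msupp (conv u x) i)) => u Cu.
  have eS : ~ msupp (conv u x) e by move=> /supp_e ux; apply: Cx; rewrite -ux.
  have oS : open (~` msupp (conv u x)) by apply: closed_openC; exact: msupp_closed.
  have ce : closed [set e] by apply: compact_closed => //; exact: compact_set1.
  have eS' : [set e] `<=` ~` msupp (conv u x) by move=> z ->.
  have [f [cf f01 f1 f0]] := urysohn_cutoff (R := R) cK hK ce oS eS'.
  have fe : f e = 1 by exact: f1.
  pose V := [set z | f z < 2^-1]; pose W := [set z | 2^-1 < f z].
  have oW : open W by exact: continuous_open_gt.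
  have oV : open V.
    have -> : V = [set z | - 2^-1 < - f z] by apply/seteqP; split=> z /=; rewrite ltrN2.
    by apply: continuous_open_gt => z; apply: cvgN; exact: cf.
  have SV : msupp (conv u x) `<=` V.
    by move=> z sz; rewrite /V /= f0 ?invr_gt0//; apply.
  have : nbhs (u, x) [set xy : K * K | msupp (conv xy.1 xy.2) `<=` V].
    by apply: open_nbhs_nbhs; split => //; exact: usc.
  case=> -[A B] /= [nA nB] AB.
  exists (A, W) => /=.
    by split=> //; apply: open_nbhs_nbhs; split => //; rewrite /W/= fe invf_lt1// ltr1n.
  move=> [u' i] /= [Au' Wi] si.
  have /(_ i si) := AB (u', x) (conj Au' (nbhs_singleton nB)).
  by rewrite /V/= => /lt_trans/(_ Wi); rewrite ltxx.
move=> /nbhs_interior; rewrite nbhsE => -[W [oW We] WP].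
exists W => // u Cu; rewrite -subset0 => i [/WP Wi].
by have := interior_subset Wi; apply.
Qed.

(* [v] in the support of [inv a * x] forces [x] into the support of [a * v]. *)
Lemma rigid_inv a : rigid a -> rigid (inv a).
Proof.
move=> ra x; apply: (msupp_Rintegral0 cK hK (rconv (inv a) x)) => [||v sv].
- exact: continuous_sqr_dist.
- by move=> w; rewrite -expr2 sqr_ge0.
suff -> : h v = h x by rewrite subrr mulr0.
apply: contrapT => hvx.
(* As [conv (inv v) (inv a)] is the image of [conv a v] under [inv], rigidity of [a] makes [g]
   vanish on its support. Thus the zero set [C] of [g] contains this support, but not [inv x], where
   [g] is [(h x - h v)^2]. *)
pose g u := (h (inv u) - h v) * (h (inv u) - h v).
have cg : continuous g.
  by move=> u; apply: (@continuous_comp _ _ _ inv (fun w => (h w - h v) * (h w - h v)));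
    [exact: cinv|exact: continuous_sqr_dist].
pose C := g @^-1` [set 0].
have cC : closed C by apply: closed_comp => [z _|]; [exact: cg|exact: closed_eq].
have [|W [oW We] WP] := @msupp_avoid x C cC.
  by rewrite /C/= /g invK => /eqP; rewrite -expr2 sqrf_eq0 subr_eq0 => /eqP/esym.
have ce : closed [set e] by apply: compact_closed => //; exact: compact_set1.
have eW : [set e] `<=` W by move=> z ->.
have [f [cf f01 f1 f0]] := urysohn_cutoff (R := R) cK hK ce oW eW.
have fge0 w : 0 <= f w by have /andP[] := f01 w.
have Wf : cutoffs W f.
  split=> // z; have /andP[fz0 fz1] := f01 z; rewrite fz0/= indicE.
  by have [_|/negP Ux] := boolP (z \in W) => //=; rewrite f0// => /mem_set.
(* Both sides integrate a cutoff [f] around [e] over [inv v * inv a * x]. The left side is 0, since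
   [u * x] avoids [W] for [u] in the support of [inv v * inv a]. The right side is positive, since
   [v] is in the support of [inv a * x] and [e] in that of [inv v * v]. *)
have := convA (inv v) (inv a) x cf.
rewrite (msupp_Rintegral0 cK hK (rconv (inv v) (inv a))); last 3 first.
- exact: continuous_convl.
- by move=> u; exact: conv_ge0.
- move=> u su; apply/eqP; rewrite eq_le conv_ge0// andbT.
  rewrite (le_trans (cutoff_le cK _ oW Wf))// (disjoint_msupp hK (rconv u x) oW)//; apply: WP.
  apply: (@msupp_Rintegral_eq0 _ _ cK (conv (inv v) (inv a)) g) => //.
    by move=> w; rewrite /g -expr2 sqr_ge0.
  rewrite -conv_inv// /g; under eq_Rintegral do rewrite invK.
  exact: ra.
move=> H; have : 0 < II (conv (inv a) x) (fun v' => II (conv (inv v) v') f).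
  apply: (@msupp_Rintegral_gt0 _ _ cK (conv (inv a) x) (fun v' => II (conv (inv v) v') f) v) => //.
  - exact: continuous_convr.
  - by move=> y; exact: conv_ge0.
  - apply: (@msupp_Rintegral_gt0 _ _ cK (conv (inv v) v) f e) => //; first exact/supp_e.
    by rewrite f1.
by rewrite -H ltxx.
Qed.

Lemma rigid_closed : closed rigid.
Proof.
have -> : rigid = \bigcap_x [set a | spread a x = 0].
  by apply/seteqP; split=> [a ra x _|a ra x]; [exact: ra|exact: ra].
apply: closed_bigI => x _.
have -> : [set a | spread a x = 0] = (fun a => spread a x) @^-1` [set 0] by [].
by apply: closed_comp => [z _|]; [exact: continuous_spread|exact: closed_eq].
Qed.

Hypothesis Ph : forall x, P h x = h x.

(** By harmonicity the [sigma]-average of [spread (inv y) z] is [P (h^2) z - (h z)^2]. This is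
    nonnegative with zero [omega]-integral by invariance, so it vanishes everywhere by
    [haar_faithful], and the spread vanishes on the support of [sigma]. *)
Lemma spread_supp y x : msupp sigma y -> spread (inv y) x = 0.
Proof.
have ch2 : continuous (fun w => h w * h w) by move=> w; apply: cvgM; exact: ch.
have cP2 := continuous_markov cK nu_continuous (sigma := sigma) ch2.
have cspr z : continuous (fun y => spread (inv y) z).
  by move=> w; apply: (@continuous_comp _ _ _ inv (fun a => spread a z));
    [exact: cinv|exact: continuous_spread].
have DE z : II sigma (fun y => spread (inv y) z) = P (fun w => h w * h w) z - h z * h z.
  under eq_Rintegral do rewrite spreadE.
  have c1 : continuous (fun y => II (nu (y, z)) (fun w => h w * h w)).
    exact: continuous_nul nu_continuous _ _ ch2.
  have c2 : continuous (fun y => II (nu (y, z)) h).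
    exact: continuous_nul nu_continuous _ _ ch.
  have c3 : continuous (fun y => 2 * h z * II (nu (y, z)) h).
    by move=> w; apply: cvgM; [exact: cvg_cst|exact: c2].
  have i1 := continuous_integrable cK sigma c1.
  have i2 := continuous_integrable cK sigma c2.
  have i3 := continuous_integrable cK sigma c3.
  rewrite RintegralD//; last 2 first.
  - apply: (@continuous_integrable _ _ cK sigma (fun y => II (nu (y, z)) (fun w => h w * h w) - 2 * h z * II (nu (y, z)) h)).
    by move=> w; apply: cvgB; [exact: c1|exact: c3].
  - exact: finite_measure_integrable_cst.
  rewrite RintegralB// RintegralZl// cst_Rintegral (_ : fine _ = 1); last first.
    exact: (congr1 fine (probability_setT sigma)).
  by rewrite -[X in _ - _ * X]/(P h z) Ph -[X in X - _]/(P (fun w => h w * h w) z); ring.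
move=> sy.
have D0 z : 0 <= P (fun w => h w * h w) z - h z * h z.
  by rewrite -DE; apply: Rintegral_ge0 => w _; exact: spread_ge0.
have Dx : P (fun w => h w * h w) x - h x * h x = 0.
  apply: (@haar_faithful (fun z => P (fun w => h w * h w) z - h z * h z)) => //.
    by move=> z; apply: cvgB; [exact: cP2|exact: ch2].
  rewrite RintegralB//; try exact: continuous_integrable.
  by rewrite markov_invariant// subrr.
apply: (@msupp_Rintegral_eq0 _ _ cK sigma (fun y => spread (inv y) x)) => //.
- by move=> z; exact: spread_ge0.
- by rewrite DE.
Qed.

Lemma harmonic_constant x : adapted conv inv sigma -> h x = h e.
Proof.
move=> adp.
have rs : msupp sigma `|` inv @` msupp sigma `<=` rigid.
  have rsi y : msupp sigma y -> rigid (inv y) by move=> sy z; exact: spread_supp.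
  by move=> y [sy|[z /rsi rz <-//]]; rewrite -(invK y); apply: rigid_inv; exact: rsi.
have rn n : setpow conv (msupp sigma `|` inv @` msupp sigma) n `<=` rigid.
  elim: n => [|n IH] //= z [a [b [/IH ra /rs rb]]]; exact: rigid_conv.
have : rigid x.
  suff : closure (\bigcup_n setpow conv (msupp sigma `|` inv @` msupp sigma) n) `<=` rigid.
    by apply; rewrite [X in X x]adp.
  have -> : rigid = closure rigid by apply/closure_id; exact: rigid_closed.
  by apply: closureS => z [n _]; exact: rn.
move=> /(_ e); rewrite /spread (conve x (@continuous_sqr_dist (h e))).2.
by move=> /eqP; rewrite -expr2 sqrf_eq0 subr_eq0 => /eqP.
Qed.

End Harmonic.
Let cP (f : K -> R) : continuous f -> continuous (P f).
Proof. by move=> cf; exact: continuous_markov nu_continuous _ cf. Qed.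

Lemma markov_opB (f g : K -> R) x : continuous f -> continuous g ->
  P (fun z => f z - g z) x = P f x - P g x.
Proof.
move=> cf cg; rewrite /markov_op -RintegralB//; last 2 first.
- by apply: continuous_integrable => //; exact: (continuous_nul nu_continuous cf).
- by apply: continuous_integrable => //; exact: (continuous_nul nu_continuous cg).
by apply: eq_Rintegral => y _; rewrite RintegralB//; exact: continuous_integrable.
Qed.

Lemma markov_op_bound (f : K -> R) M x : continuous f -> (forall z, `|f z| <= M) ->
  `|P f x| <= M.
Proof.
move=> cf fM.
have nu1 y : `|II (nu (y, x)) f| <= M.
  have := Rintegral_bound cK (nu (y, x)) cf fM.
  by rewrite (_ : fine _ = 1) ?mulr1//; exact: (congr1 fine (probability_setT (nu (y, x)))).
have := Rintegral_bound cK sigma (continuous_nul nu_continuous (x := x) cf) nu1.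
by rewrite (_ : fine _ = 1) ?mulr1//; exact: (congr1 fine (probability_setT sigma)).
Qed.

(** * Smoothing and approximation *)

Section Smoothing.
Variable psi : K -> R.
Hypotheses (cpsi : continuous psi) (psi1 : forall z, `|psi z| <= 1).

(** The operator [Q] of the outline, here applied to continuous [k] only. *)
Definition smoothing (k : K -> R) (x : K) := II omega (fun z => psi z * II (conv x z) k).

Lemma continuous_kernel (k : K -> R) x : continuous k ->
  continuous (fun z => psi z * II (conv x z) k).
Proof.
by move=> ck z; apply: cvgM; [exact: cpsi|exact: continuous_convr].
Qed.

Lemma continuous_smoothing (k : K -> R) : continuous k -> continuous (smoothing k).
Proof.
move=> ck; apply: (@cvg_continuous_Rintegral _ _ cK _ (fun=> omega) (fine (omega setT))
  (fun p => psi p.1 * II (conv p.2 p.1) k)) => //.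
- by move=> g _ x; exact: cvg_cst.
- move=> p; apply: cvgM.
    by apply: (@continuous_comp _ _ _ fst psi); [exact: cvg_fst|exact: cpsi].
  by apply: (continuous_comp2 (cconv ck)) => q; [exact: cvg_snd|exact: cvg_fst].
Qed.

Lemma smoothingB (f g : K -> R) x : continuous f -> continuous g ->
  smoothing (fun z => f z - g z) x = smoothing f x - smoothing g x.
Proof.
move=> cf cg; rewrite /smoothing -RintegralB//; last 2 first.
- by apply: continuous_integrable => //; exact: continuous_kernel.
- by apply: continuous_integrable => //; exact: continuous_kernel.
apply: eq_Rintegral => y _; rewrite -mulrBr RintegralB//; exact: continuous_integrable.
Qed.

Lemma smoothing_bound (k : K -> R) x : continuous k ->
  `|smoothing k x| <= II omega (fun z => `|k z|).
Proof.
move=> ck; have cnk : continuous (fun z => `|k z|) by move=> z; apply: cvg_norm; exact: ck.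
have ckx := @continuous_kernel k x ck.
apply: le_trans (le_normr_Rintegral _ _) _ => //; first exact: continuous_integrable.
rewrite -(haar x cnk); apply: le_continuous_Rintegral => //.
- by move=> z; apply: cvg_norm; exact: ckx.
- exact: continuous_convr.
move=> z; rewrite normrM (@le_trans _ _ (`|II (conv x z) k|))// ?ler_piMl//.
by apply: le_normr_Rintegral => //; exact: continuous_integrable.
Qed.

(** Translation by [inv y] on the left commutes with translation by [z] on the right by
    associativity; the rest exchanges integrals by Fubini. *)
Lemma markov_smoothing (k : K -> R) x : continuous k ->
  P (smoothing k) x = smoothing (P k) x.
Proof.
move=> ck.
have cG : continuous (fun p : K * K => psi p.2 * II (conv p.1 p.2) k).
  move=> p; apply: cvgM; last exact: cconv.
  by apply: (@continuous_comp _ _ _ snd psi); [exact: cvg_snd|exact: cpsi].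
have cky y : continuous (fun v => II (conv (inv y) v) k) by exact: continuous_convr.
have cH : continuous (fun p : K * K => II (conv x p.2) (fun v => II (conv (inv p.1) v) k)).
  apply: (@cvg_continuous_Rintegral _ _ cK _ (fun p : K * K => conv x p.2) 1
    (fun q : K * (K * K) => II (conv (inv q.2.1) q.1) k)).
  - by move=> p; rewrite (_ : fine _ = 1)//; exact: (congr1 fine (probability_setT (conv x p.2))).
  - move=> f cf p.
    apply: (@continuous_comp _ _ _ snd (fun z => II (conv x z) f)); first exact: cvg_snd.
    exact: continuous_convr.
  - apply: (continuous_comp2 (cconv ck)) => q; last exact: cvg_fst.
    apply: (@continuous_comp _ _ _ (fun q : K * (K * K) => q.2.1) inv); last exact: cinv.
    apply: (@continuous_comp _ _ _ snd fst); [exact: cvg_snd|exact: cvg_fst].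
transitivity (II sigma (fun y => II omega (fun z => psi z *
    II (conv x z) (fun v => II (conv (inv y) v) k)))).
  apply: eq_Rintegral => y _; rewrite /smoothing.
  have := Fubini_continuous cK (conv (inv y) x) omega cG => /= ->.
  apply: eq_Rintegral => z _; rewrite RintegralZl//; first by rewrite convA.
  by apply: continuous_integrable => //; exact: continuous_convl.
have cH' : continuous (fun p : K * K => psi p.2 *
    II (conv x p.2) (fun v => II (conv (inv p.1) v) k)).
  move=> p; apply: cvgM; last exact: cH.
  by apply: (@continuous_comp _ _ _ snd psi); [exact: cvg_snd|exact: cpsi].
have := Fubini_continuous cK sigma omega cH' => /= ->.
apply: eq_Rintegral => z _; rewrite RintegralZl//; last first.
  apply: continuous_integrable => //.
  by apply: (continuous_comp2 cH) => y; [exact: cvg_id|exact: cvg_cst].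
congr (_ * _).
have := Fubini_continuous cK sigma (conv x z) (nu_continuous ck).
by rewrite /nu/=.
Qed.

End Smoothing.

Lemma dist_third (q q' a b eps : R) : `|q - a| <= eps / 3 -> `|q - q'| < eps / 3 ->
  `|q' - b| <= eps / 3 -> `|a - b| < eps.
Proof.
rewrite !ltr_norml !ler_norml => /andP[? ?] /andP[? ?] /andP[? ?].
by apply/andP; split; lra.
Qed.

Lemma dist_quarter (a b c d eps : R) : `|a - b| <= eps / 4 -> `|b - c| <= 2 * (eps / 4) ->
  `|c - d| <= eps / 4 -> `|a - d| <= eps.
Proof.
rewrite !ler_norml => /andP[? ?] /andP[? ?] /andP[? ?].
by apply/andP; split; lra.
Qed.

Lemma dist_sub_le_add (q q' a b : R) : `|q - q'| <= a + b -> q - a <= q' + b.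
Proof. by rewrite ler_norml => /andP[_]; lra. Qed.

(* [near k eps] stands for [k] continuous at [L^1]-distance at most [eps] of a fixed
   harmonic function, which itself need not be continuous. *)
Section Approximation.
Variable near : (K -> R) -> R -> Prop.
Hypotheses (near_continuous : forall k eps, near k eps -> continuous k)
  (near_ex : forall eps, 0 < eps -> exists k, near k eps)
  (near_dist : forall k l a b, near k a -> near l b ->
    II omega (fun z => `|k z - l z|) <= a + b)
  (near_harmonic : forall k eps, near k eps ->
    II omega (fun z => `|P k z - k z|) <= 2 * eps).
Hypothesis adp : adapted conv inv sigma.

(** The uniform limit [h] of the functions [Q k] plays the role of [Q u]. It inherits continuity,
    and harmonicity through [markov_smoothing], so it is constant. *)
Lemma smoothing_limit (psi : K -> R) : continuous psi -> (forall z, `|psi z| <= 1) ->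
  exists c : R, forall k eps x, near k eps -> `|smoothing psi k x - c| <= eps.
Proof.
move=> cpsi psi1; pose Q := smoothing psi.
have cQ k : continuous k -> continuous (Q k) by exact: continuous_smoothing.
have Qd k l a b x : near k a -> near l b -> `|Q k x - Q l x| <= a + b.
  move=> nk nl; have [ck cl] := (near_continuous nk, near_continuous nl).
  rewrite -smoothingB// (le_trans (smoothing_bound _ _ _ _) (near_dist nk nl))//.
  by move=> z; apply: cvgB; [exact: ck|exact: cl].
(* Every lower bound [Q k x - a] lies below every upper bound [Q l x + b], so the supremum is within
   [a] of [Q k x] for all approximants at once. *)
pose E x := [set r | exists k a, near k a /\ r = Q k x - a].
pose h x := sup (E x).
have Eub k a x : near k a -> ubound (E x) (Q k x + a).
  move=> nk _ [l [b [nl ->]]]; exact: dist_sub_le_add (Qd _ _ _ _ x nl nk).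
have hQ k a x : near k a -> `|Q k x - h x| <= a.
  move=> nk; have h1 : Q k x - a <= h x.
    by apply: ub_le_sup; [exists (Q k x + a); exact: Eub|exists k, a].
  have h2 : h x <= Q k x + a by apply: ge_sup; [exists (Q k x - a), k, a|exact: Eub].
  by rewrite ler_norml; apply/andP; split; lra.
have ch : continuous h.
  move=> x; apply/cvgrPdist_lt => eps e0.
  have e3 : 0 < eps / 3 by rewrite divr_gt0.
  have [k nk] := near_ex e3.
  have ck := near_continuous nk.
  have /cvgrPdist_lt/(_ _ e3) := cQ k ck x; apply: filterS => y Qxy.
  exact: dist_third (hQ _ _ x nk) Qxy (hQ _ _ y nk).
have Ph x : P h x = h x.
  apply/eqP; rewrite -subr_eq0 -normr_le0; apply/ler_addgt0Pl => eps e0; rewrite addr0.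
  have e4 : 0 < eps / 4 by rewrite divr_gt0.
  have [k nk] := near_ex e4; have ck := near_continuous nk; have cQk := cQ k ck.
  have H1 : `|P h x - P (Q k) x| <= eps / 4.
    rewrite -markov_opB//; apply: markov_op_bound.
      by move=> z; apply: cvgB; [exact: ch|exact: cQk].
    by move=> z; rewrite distrC; exact: hQ.
  have H2 : `|P (Q k) x - Q k x| <= 2 * (eps / 4).
    rewrite markov_smoothing// -smoothingB//; last exact: cP.
    apply: le_trans (smoothing_bound _ _ _ _) (near_harmonic nk) => //.
    by move=> z; apply: cvgB; [exact: cP|exact: ck].
  have H3 := hQ _ _ x nk.
  exact: dist_quarter H1 H2 H3.
exists (h e) => k a x nk; rewrite -(harmonic_constant ch Ph x adp); exact: hQ.
Qed.

Lemma smoothing_e psi (k : K -> R) : continuous k ->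
  smoothing psi k e = II omega (fun z => psi z * k z).
Proof.
by move=> ck; apply: eq_Rintegral => z _; rewrite (conve z ck).1.
Qed.

(* The image of [omega] under [inv] is right invariant; this replaces the
   unimodularity of compact hypergroups. *)
Lemma smoothing_inv psi (k : K -> R) : continuous psi -> continuous k ->
  II omega (fun x => smoothing psi k (inv x)) =
  II omega psi * II omega (fun z => k (inv z)).
Proof.
move=> cpsi ck.
have cki : continuous (fun z => k (inv z)).
  by move=> z; apply: (@continuous_comp _ _ _ inv k); [exact: cinv|exact: ck].
have cG : continuous (fun p : K * K => psi p.2 * II (conv (inv p.1) p.2) k).
  move=> p; apply: cvgM; last exact: (nu_continuous ck).
  by apply: (@continuous_comp _ _ _ snd psi); [exact: cvg_snd|exact: cpsi].
have := Fubini_continuous cK omega omega cG => /= ->.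
rewrite -[RHS]mulrC -RintegralZl//; last exact: continuous_integrable.
apply: eq_Rintegral => z _; rewrite RintegralZl//; last first.
  apply: continuous_integrable => //.
  by apply: (continuous_comp2 (nu_continuous ck)) => x; [exact: cvg_id|exact: cvg_cst].
rewrite mulrC; congr (_ * _); rewrite -(haar (inv z) cki).
by apply: eq_Rintegral => x _; rewrite conv_inv// invK.
Qed.

Let W := fine (omega setT).

(** Since [smoothing phi k] is within [eps] of a constant, its value at [e] can be compared with its
    integral along [inv], computed by [smoothing_inv]. This leaves the integral of [k (inv z)],
    which the case [phi = 1] replaces by that of [k] at a further cost of [2 * W * eps]. *)
Lemma near_pairing (psi k : K -> R) eps : continuous psi -> (forall z, `|psi z| <= 1) ->
  near k eps -> `|II omega psi * II omega k - W * II omega (fun z => psi z * k z)| <= 4 * W * eps.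
Proof.
move=> cpsi psi1 nk; have ck := near_continuous nk.
have step (phi : K -> R) : continuous phi -> (forall z, `|phi z| <= 1) ->
  `|II omega phi * II omega (fun z => k (inv z)) - W * II omega (fun z => phi z * k z)| <= 2 * W * eps.
  move=> cphi phi1; have [c cP'] := smoothing_limit cphi phi1.
  have cQ := @continuous_smoothing _ cphi k ck.
  have cQi : continuous (fun x => smoothing phi k (inv x)).
    by move=> z; apply: (@continuous_comp _ _ _ inv (smoothing phi k)); [exact: cinv|exact: cQ].
  rewrite -smoothing_inv//.
  have H1 : `|II omega (fun x => smoothing phi k (inv x)) - c * W| <= eps * W.
    rewrite -(cst_Rintegral omega) -RintegralB//; last 2 first.
    - exact: continuous_integrable.
    - exact: finite_measure_integrable_cst.
    apply: (@Rintegral_bound _ _ cK omega (fun x => smoothing phi k (inv x) - c)).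
      by move=> z; apply: cvgB; [exact: cQi|exact: cvg_cst].
    by move=> z; exact: cP'.
  have H2 : `|W * smoothing phi k e - W * c| <= W * eps.
    by rewrite -mulrBr normrM gtr0_norm// ler_pM2l//; exact: cP'.
  rewrite smoothing_e// in H2.
  rewrite (_ : _ - _ = (II omega (fun x => smoothing phi k (inv x)) - c * W) -
    (W * II omega (fun z => phi z * k z) - W * c)); last by ring.
  by rewrite (le_trans (ler_normB _ _))//; lra.
have cst1 (z : K) : `|1 : R| <= 1 by rewrite normr1.
have := step (fun=> 1) (fun z => cvg_cst _) cst1.
have -> : II omega (fun z => 1 * k z) = II omega k.
  by apply: eq_Rintegral => z _; rewrite mul1r.
rewrite cst_Rintegral mul1r -/W -mulrBr normrM (gtr0_norm omega_gt0) -/W.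
rewrite (_ : 2 * W * eps = W * (2 * eps)); last by ring.
rewrite (ler_pM2l omega_gt0) => H1.
have H2 := step _ cpsi psi1.
have H3 : `|II omega psi| <= W.
  by rewrite -[leRHS]mul1r; apply: Rintegral_bound.
have H4 : `|II omega psi * (II omega k - II omega (fun z => k (inv z)))| <= W * (2 * eps).
  rewrite normrM; apply: (ler_pM (normr_ge0 _) (normr_ge0 _) H3).
  by rewrite distrC; exact: H1.
rewrite (_ : _ - _ = (II omega psi * (II omega k - II omega (fun z => k (inv z)))) +
  (II omega psi * II omega (fun z => k (inv z)) - W * II omega (fun z => psi z * k z))); last by ring.
have -> : 4 * W * eps = W * (2 * eps) + 2 * W * eps by ring.
exact: le_trans (ler_normD _ _) (lerD H4 H2).
Qed.

(** Testing [near_pairing] on an approximate sign of [k - m] turns the pairing estimate into an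
    [L^1] estimate. *)
Lemma near_constant k eps : near k eps ->
  II omega (fun z => `|k z - II omega k / W|) <= 4 * eps.
Proof.
move=> nk; have ck := near_continuous nk.
set m := II omega k / W.
have ckm : continuous (fun z => k z - m) by move=> z; apply: cvgB; [exact: ck|exact: cvg_cst].
have cnkm : continuous (fun z => `|k z - m|) by move=> z; apply: cvg_norm; exact: ckm.
apply/ler_addgt0Pl => d0 d00.
(* A pointwise error [d] integrates to [d * W = d0]. *)
pose d := d0 / W; have d1 : 0 < d by rewrite divr_gt0.
have den z : 0 < `|k z - m| + d by rewrite ltr_wpDl.
(* a continuous approximation of the sign of [k - m] *)
pose psi z := (k z - m) / (`|k z - m| + d).
have cpsi : continuous psi.
  move=> z; apply: cvgM; first exact: ckm.
  apply: cvgV; first by rewrite gt_eqF.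
  by apply: cvgD; [exact: cnkm|exact: cvg_cst].
have psi1 z : `|psi z| <= 1.
  rewrite /psi normrM normfV (gtr0_norm (den z)) ler_pdivrMr// mul1r.
  by rewrite lerDl ltW.
have := near_pairing cpsi psi1 nk => H.
have cpk : continuous (fun z => psi z * k z).
  by move=> z; apply: cvgM; [exact: cpsi|exact: ck].
have cpkm : continuous (fun z => psi z * (k z - m)).
  by move=> z; apply: cvgM; [exact: cpsi|exact: ckm].
have E : II omega (fun z => psi z * (k z - m)) = II omega (fun z => psi z * k z) - m * II omega psi.
  rewrite -RintegralZl//; last exact: continuous_integrable.
  rewrite -RintegralB//; last 2 first.
  - exact: continuous_integrable.
  - by apply: (@continuous_integrable _ _ cK omega (fun z => m * psi z)) => z;
      apply: cvgM; [exact: cvg_cst|exact: cpsi].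
  by apply: eq_Rintegral => z _; rewrite mulrBr [psi z * m]mulrC.
have H1 : II omega (fun z => psi z * (k z - m)) <= 4 * eps.
  rewrite E -(ler_pM2l omega_gt0) -/W mulrBr (_ : W * (m * _) = II omega psi * II omega k); last first.
    by rewrite /m; field; rewrite gt_eqF.
  by move: H; rewrite ler_norml => /andP[+ _]; lra.
apply: (@le_trans _ _ (II omega (fun z => psi z * (k z - m) + d))).
  apply: le_continuous_Rintegral => //.
    by move=> z; apply: cvgD; [exact: cpkm|exact: cvg_cst].
  (* The claim is [|t| - d <= t^2 / (|t| + d)], which holds because
     [(|t| - d) (|t| + d) = t^2 - d^2]. *)
  move=> z; rewrite /psi; set t := k z - m; have := den z; rewrite -/t => dt.
  rewrite mulrAC -expr2 -real_normK ?num_real// -lerBlDr ler_pdivlMr//.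
  by rewrite mulrBl; have := normr_ge0 t; nra.
rewrite RintegralD//; last 2 first.
- exact: continuous_integrable.
- exact: finite_measure_integrable_cst.
rewrite cst_Rintegral -/W /d divfK ?gt_eqF//; lra.
Qed.

End Approximation.
End Rigidity.

(** * Integrable harmonic functions *)

Section FiniteMeasure.
Context d (T : measurableType d) (R : realType) (mu : {measure set T -> \bar R}).

(** The same set function under a name carrying the finiteness proof, so that a finite measure
    structure can be attached to it. *)
Definition finite_part of (mu setT < +oo)%E : set T -> \bar R := mu.

Hypothesis muT : (mu setT < +oo)%E.

HB.instance Definition _ := Measure.copy (finite_part muT) mu.

Let fin : fin_num_fun (finite_part muT).
Proof.
move=> A mA; rewrite ge0_fin_numE//; apply: le_lt_trans muT.
by apply: le_measure => //; exact: mem_set.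
Qed.

HB.instance Definition _ := Measure_isFinite.Build _ _ _ (finite_part muT) fin.

End FiniteMeasure.

Section Integrability.
Context d (T : measurableType d) (R : realType) (mu : {measure set T -> \bar R}).
Hypothesis muT : (mu setT < +oo)%E.
Local Open Scope ereal_scope.

Lemma Lnorm_integrable (p : \bar R) (w : T -> R) : 1 <= p ->
  measurable_fun [set: T] w -> Lnorm mu p (EFin \o w) < +oo ->
  mu.-integrable [set: T] (EFin \o w).
Proof.
move=> p1 mw wp.
have : w \in Lfun mu p.
  by rewrite inE; apply/andP; split; exact: mem_set.
have fT : mu [set: T] \is a fin_num by rewrite ge0_fin_numE.
move=> /(Lfun_subset (lexx 1) p1 fT p1).
rewrite inE => /andP[_ /set_mem]; rewrite /= /finite_norm Lnorm1 => w1.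
by apply/integrableP; split=> //; exact/measurable_EFinP.
Qed.

Lemma Lnorm_cst_lty (p : \bar R) (c : R) : 1 <= p -> Lnorm mu p (cst c%:E) < +oo.
Proof.
case: p => [r r1|_|//]; rewrite unlock /=.
  apply: poweR_lty; rewrite integral_cst//.
  by rewrite ltey_eq fin_numM// ge0_fin_numE.
by case: ifPn => // mu0; rewrite (@ess_sup_ae_cst _ _ _ mu _ `|c|%:E)// ?ltry//; exact: nearW.
Qed.

End Integrability.

(** * The hypergroup axioms in terms of real-valued integrals *)

Section HypergroupIntegrals.
Context {R : realType} {K : ptopologicalType}.

Lemma continuous_measurable_map (f : K -> K) : continuous f ->
  measurable_fun [set: Borel K] (f : Borel K -> Borel K).
Proof.
move=> cf; apply: (@measurability _ _ (Borel K) (Borel K) _ _ (@open K)) => //.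
move=> _ [U oU <-]; rewrite setTI; apply: open_measurable_Borel.
by apply: open_comp => // x _; exact: cf.
Qed.

Variables (conv : K -> K -> probability (Borel K) R) (e : K) (inv : K -> K).
Hypothesis HG : is_compact_hypergroup conv e inv.

Lemma hypergroup_compact : compact [set: K].
Proof. by case: HG => -[]. Qed.

Lemma hypergroup_hausdorff : hausdorff_space K.
Proof. by case: HG => -[]. Qed.

Let cK := hypergroup_compact.

Lemma fconvE (f : K -> R) x y : continuous f -> fconv conv f x y = (II (conv x y) f)%:E.
Proof. by move=> cf; rewrite -(continuous_integralE cK (conv x y) cf). Qed.

Lemma hypergroup_convA x y z (f : K -> R) : continuous f ->
  II (conv x y) (fun u => II (conv u z) f) = II (conv y z) (fun v => II (conv x v) f).
Proof.
move=> cf; case: HG => _ _ [+ _] _ _ => /(_ x y z f cf) /(congr1 fine).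
under eq_integral do rewrite fconvE//.
by under [X in _ = fine X -> _]eq_integral do rewrite fconvE//.
Qed.

Lemma hypergroup_continuous (f : K -> R) : continuous f ->
  continuous (fun xy : K * K => II (conv xy.1 xy.2) f).
Proof.
move=> cf; case: HG => _ _ [_ /(_ f cf)] + _ _.
have -> : (fun xy : K * K => fconv conv f xy.1 xy.2) =
    (fun xy => (II (conv xy.1 xy.2) f)%:E).
  by apply/funext => xy; exact: fconvE.
by move=> cE p; have /fine_cvgP[] := cE p.
Qed.

Lemma hypergroup_conve x (f : K -> R) : continuous f ->
  II (conv e x) f = f x /\ II (conv x e) f = f x.
Proof.
move=> cf; case: HG => _ _ _ _ [he _ _ _].
have mf : measurable_fun [set: Borel K] (EFin \o f).
  by apply/measurable_EFinP; exact: continuous_measurable.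
have diracI (m : probability (Borel K) R) :
    (forall A : set (Borel K), measurable A -> m A = (\1_A x)%:E) -> II m f = f x.
  move=> mx; rewrite /Rintegral (@eq_measure_integral _ _ _ _ (\d_(x : Borel K))).
    by rewrite integral_dirac// diracT mul1e.
  by move=> A mA _; exact: mx.
by split; apply: diracI => A /(he x A)[].
Qed.

Lemma hypergroup_conv_inv x y (f : K -> R) : continuous f ->
  II (conv x y) (fun w => f (inv w)) = II (conv (inv y) (inv x)) f.
Proof.
move=> cf; case: HG => _ _ _ _ [_ [cinv _] hi _]; rewrite /Rintegral; congr fine.
have minv := continuous_measurable_map cinv.
have cfi : continuous (fun w => f (inv w)).
  by move=> z; apply: (@continuous_comp _ _ _ inv f); [exact: cinv|exact: cf].
rewrite [RHS](@eq_measure_integral _ _ _ _ (pushforward (conv x y) (inv : Borel K -> Borel K))).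
  rewrite integral_pushforward//.
  - by apply/measurable_EFinP; exact: continuous_measurable.
  - by rewrite preimage_setT; exact: (continuous_integrable cK (conv x y) cfi).
by move=> A mA _; apply/esym; exact: hi.
Qed.

End HypergroupIntegrals.

Section HarmonicFunctions.
Context {R : realType} {K : ptopologicalType}.
Variables (conv : K -> K -> probability (Borel K) R) (e : K) (inv : K -> K).
Variables (omega : {finite_measure set (Borel K) -> \bar R})
  (sigma : probability (Borel K) R).
Hypotheses (HG : is_compact_hypergroup conv e inv) (HH : is_left_haar conv omega)
  (rsigma : radon sigma) (adp : adapted conv inv sigma).

Lemma haarE x (f : K -> R) : continuous f ->
  II omega (fun y => II (conv x y) f) = II omega f.
Proof.
move=> cf; case: HH => _ _ /(_ x f cf) /(congr1 fine).
by under eq_integral do rewrite (fconvE HG)//.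
Qed.

Lemma harmonic_ae_constant (u : K -> R) :
  omega.-integrable [set: Borel K] (EFin \o (u : Borel K -> R)) ->
  {ae omega, forall x : Borel K, mconv conv inv sigma u x = (u x)%:E} ->
  exists a : R, {ae omega, forall x : Borel K, u x = a}.
Proof.
move=> iu hu.
have cK := hypergroup_compact HG; have hK := hypergroup_hausdorff HG.
have [_ rc _ usc [_ [cinv invK] _ supp_e]] := HG.
have rconv x y : radon (conv x y) by have [] := rc x y.
have [romega omega0 _] := HH.
have mu : measurable_fun [set: Borel K] (u : Borel K -> R).
  by apply/measurable_EFinP; exact: measurable_int iu.
pose nu (p : K * K) : probability (Borel K) R := conv (inv p.1) p.2.
have cconv := hypergroup_continuous HG.
have cnu := nu_continuous cconv cinv.
have invP := markov_invariant cK sigma cconv cinv haarE.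
pose near (k : K -> R) (eps : R) := continuous k /\
  (\int[omega]_(x in [set: Borel K]) `|u x - k x|%:E <= eps%:E)%E.
have triangle (k l : K -> R) a b : continuous k -> continuous l ->
    (\int[omega]_(x in [set: Borel K]) `|u x - k x|%:E <= a%:E)%E ->
    (\int[omega]_(x in [set: Borel K]) `|u x - l x|%:E <= b%:E)%E ->
    II omega (fun z => `|k z - l z|) <= a + b.
  move=> ck cl ka lb; rewrite -lee_fin -continuous_integralE//; last first.
    by move=> z; apply: cvg_norm; apply: cvgB; [exact: ck|exact: cl].
  have [mk ml] := (continuous_measurable ck, continuous_measurable cl).
  apply: le_trans (L1_triangle omega mk mu ml) _; rewrite EFinD; apply: leeD => //.
  by under eq_integral do rewrite distrC.
(* The contraction puts [markov_op nu sigma k] as close to [u] as [k] is; the triangle inequality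
   then gives the distance [2 * eps] between the two. *)
have nearP k eps : near k eps ->
    (\int[omega]_(x in [set: Borel K]) `|u x - markov_op nu sigma k x|%:E <= eps%:E)%E.
  move=> [ck uk]; apply: (markov_L1 cK hK) => //; by move=> p; exact: rconv.
have W0 : 0 < fine (omega setT).
  by rewrite fine_gt0// omega0/= ltey_eq fin_num_measure.
have nearC k eps : near k eps ->
    II omega (fun z => `|k z - II omega k / fine (omega setT)|) <= 4 * eps.
  apply: (near_constant cK hK rconv (hypergroup_convA HG) cconv _ (hypergroup_conve HG)
    cinv invK (hypergroup_conv_inv HG) supp_e romega W0 haarE) => //.
  - by move=> U /usc[].
  - by move=> {}k {}eps [].
  - move=> d d0; have [_ /(_ d d0)[l cl ul]] := integrable_approximable cK hK romega iu.
    by exists l; split => //; exact: ltW.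
  - by move=> l l' a b [cl ?] [cl' ?]; exact: triangle.
  - move=> l a nl; have [cl ul] := nl; rewrite mulr_natl mulr2n.
    apply: triangle => //; last exact: nearP.
    exact: (continuous_markov cK cnu).
  - exact: adp.
set W := fine (omega setT) in W0 nearC *.
pose m := II omega u / W; exists m.
have cst_meas (c : R) : measurable_fun [set: Borel K] (cst c : Borel K -> R) by [].
have int0 : (\int[omega]_(x in [set: Borel K]) `|u x - m|%:E = 0)%E.
  apply/eqP; rewrite eq_le integral_ge0// andbT.
  apply/lee_addgt0Pr => d d0; rewrite add0e.
  (* One [eps] from [u] to [k], four from [k] to its mean [mk'] by [nearC], and one from [mk'] to
     [m]. *)
  pose eps := d / 6; have eps0 : 0 < eps by rewrite divr_gt0.
  have [_ /(_ eps eps0)[k ck uk]] := integrable_approximable cK hK romega iu.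
  have nk : near k eps by split => //; exact: ltW.
  have mk := continuous_measurable ck.
  have ik := continuous_integrable cK omega ck.
  set mk' := II omega k / W.
  have H1 : (\int[omega]_(x in [set: Borel K]) `|k x - mk'|%:E <= (4 * eps)%:E)%E.
    rewrite continuous_integralE//; first by rewrite lee_fin; exact: nearC.
    by move=> z; apply: cvg_norm; apply: cvgB; [exact: ck|exact: cvg_cst].
  have H2 : `|II omega k - II omega u| <= eps.
    rewrite -RintegralB//; apply: le_trans (le_normr_Rintegral _ _) _ => //.
      exact: (integrableB _ ik iu).
    rewrite -lee_fin /Rintegral fineK.
      by under eq_integral do rewrite distrC; exact: ltW.
    rewrite ge0_fin_numE ?integral_ge0//; under eq_integral do rewrite distrC.
    exact: lt_trans uk (ltry _).
  apply: le_trans (L1_triangle omega mu mk (cst_meas m)) _.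
  apply: (@le_trans _ _ (eps%:E + ((4 * eps)%:E + eps%:E))%E); last first.
    by rewrite -!EFinD lee_fin /eps; lra.
  apply: leeD; first exact: ltW.
  apply: le_trans (L1_triangle omega mk (cst_meas mk') (cst_meas m)) _; apply: leeD => //.
  rewrite /= integral_cst// -[X in (_ * X)%E]fineK ?fin_num_measure// -EFinM lee_fin.
  by rewrite /mk' /m -mulrBl normrM normfV (gtr0_norm W0) divfK ?gt_eqF.
have mD := measurable_dist mu (cst_meas m).
have : ae_eq omega [set: Borel K] (fun x : Borel K => `|u x - m|%:E) (cst 0)%E.
  apply/ae_eq_integral_abs => //; rewrite -[RHS]int0.
  by apply: eq_integral => x _; rewrite /= normr_id.
apply: filterS => x /(_ I) /= [] /eqP; rewrite normr_eq0 subr_eq0 => /eqP //.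
Qed.

End HarmonicFunctions.

(** * Integrability of [L^p] functions, and constants as members of [Hp] *)

Section Lp.
Context {R : realType} {K : ptopologicalType}.
Variable omega : {measure set (Borel K) -> \bar R}.
Hypothesis omegaT : (omega setT < +oo)%E.

(** The modulus is integrable because [omega] is finite, and it dominates both components. *)
Lemma inLp_integrable (p : \bar R) (u v : K -> R) : (1 <= p)%E -> inLp omega p u v ->
  omega.-integrable [set: Borel K] (EFin \o (u : Borel K -> R)) /\
  omega.-integrable [set: Borel K] (EFin \o (v : Borel K -> R)).
Proof.
move=> p1 [mu mv uvp]; pose w (x : Borel K) := Num.sqrt (u x ^+ 2 + v x ^+ 2).
have mw : measurable_fun [set: Borel K] w.
  apply: (measurableT_comp (continuous_measurable_fun (@sqrt_continuous R))).
  by apply: measurable_funD; exact: measurable_funX.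
have iw : omega.-integrable [set: Borel K] (EFin \o w) by exact: Lnorm_integrable uvp.
have w0 x : 0 <= w x by exact: sqrtr_ge0.
split.
- apply: (le_integrable _ _ _ iw) => //; first exact/measurable_EFinP.
  move=> x _ /=; rewrite lee_fin (ger0_norm (w0 x)) -sqrtr_sqr ler_wsqrtr//.
  by rewrite lerDl sqr_ge0.
- apply: (le_integrable _ _ _ iw) => //; first exact/measurable_EFinP.
  move=> x _ /=; rewrite lee_fin (ger0_norm (w0 x)) -sqrtr_sqr ler_wsqrtr//.
  by rewrite lerDr sqr_ge0.
Qed.

Lemma mconv_cst (conv : K -> K -> probability (Borel K) R) (inv : K -> K)
    (sigma : probability (Borel K) R) (a : R) (x : K) :
  mconv conv inv sigma (fun=> a) x = a%:E.
Proof.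
have cst1 (m : probability (Borel K) R) : (\int[m]_(w in [set: Borel K]) a%:E = a%:E)%E.
  by rewrite integral_cst// [X in (_ * X)%E](probability_setT m) mule1.
rewrite /mconv /fconv -[RHS](cst1 sigma).
by apply: eq_integral => y _; exact: cst1.
Qed.

Lemma constant_Hp (conv : K -> K -> probability (Borel K) R) (inv : K -> K)
    (sigma : probability (Borel K) R) (p : \bar R) (a b : R) :
  (1 <= p)%E -> Hp conv inv omega sigma p (fun=> a) (fun=> b).
Proof.
move=> p1; split; [split => //|apply/nearW => x|apply/nearW => x].
- exact: Lnorm_cst_lty.
- exact: mconv_cst.
- exact: mconv_cst.
Qed.

End Lp.

Unset Implicit Arguments.
Set Strict Implicit.

(* H^p_sigma(K) = C 1 for 1 <= p <= oo: constants lie in H^p_sigma, and every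
   element of H^p_sigma is omega-a.e. equal to a constant a + i b. *)
Theorem theorem4p12 (R : realType) (K : ptopologicalType)
    (conv : K -> K -> probability (Borel K) R) (e : K) (inv : K -> K)
    (omega : {measure set (Borel K) -> \bar R})
    (sigma : probability (Borel K) R) (p : \bar R) :
  is_compact_hypergroup conv e inv ->
  is_left_haar conv omega ->
  radon sigma ->
  adapted conv inv sigma ->
  (1 <= p)%E ->
  (forall a b : R, Hp conv inv omega sigma p (fun _ => a) (fun _ => b)) /\
  (forall u v : K -> R, Hp conv inv omega sigma p u v ->
     exists a b : R, {ae omega, forall x : Borel K, u x = a} /\
                     {ae omega, forall x : Borel K, v x = b}).
Proof.
move=> HG HH rs adp p1; have [[omegaT _] _ _] := HH.
split=> [a b|u v [uvp hu hv]]; first exact: constant_Hp.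
have [iu iv] := inLp_integrable omegaT p1 uvp.
have HC := @harmonic_ae_constant R K conv e inv (finite_part omegaT) sigma HG HH rs adp.
have [a ua] := HC u iu hu; have [b vb] := HC v iv hv.
by exists a, b.
Qed.
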